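(* Let $\mathcal{C}$ be a $k$-linear Reedy category with degree function $\deg\colon\operatorname{Obj}(\mathcal{C})\to\lambda$. Then for any objects $c,d$ in $\mathcal{C}$ the following hold: (i) $\operatorname{End}_{\mathcal{C}}(\Delta_c)\cong k\cong\Delta^c\otimes_{\mathcal{C}}\Delta_c$. (ii) If $\operatorname{Hom}_{\mathcal{C}}(\Delta_c,\Delta_d)\neq 0$, then $\deg(d)<\deg(c)$ or $d=c$. (iii) For all $n\geq 1$, if $\operatorname{Ext}^n_{\mathcal{C}}(\Delta_c,\Delta_d)\neq 0$, then $\deg(d)<\deg(c)$. (iv) For all $n\geq 0$, $\operatorname{Tor}_n^{\mathcal{C}}(\Delta^c,\Delta_d)\neq 0$ if and only if $n=0$ and $c=d$.
   Context: $k$ is a field and $\mathcal{K}$ is the category of $k$-vector spaces. A small $k$-linear category $\mathcal{D}$ is called direct (resp. inverse) if $\operatorname{End}_{\mathcal{D}}(c)\cong k$ for every object $c$, and there are an ordinal $\lambda$ and a function $\deg\colon\operatorname{Obj}(\mathcal{D})\to\lambda$ such that every non-zero non-endomorphism $c\to c'$ satisfies $\deg(c)<\deg(c')$ (resp. $\deg(c)>\deg(c')$). A small $k$-linear category $\mathcal{C}$ is called $k$-linear Reedy if there are an ordinal $\lambda$, a function $\deg\colon\operatorname{Obj}(\mathcal{C})\to\lambda$, and two $k$-linear subcategories $\mathcal{C}^+,\mathcal{C}^-$ of $\mathcal{C}$ with the same objects as $\mathcal{C}$, with $\mathcal{C}^+$ direct and $\mathcal{C}^-$ inverse with respect to the same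 function $\deg$, such that for all objects $c,d$ composition induces a $k$-linear isomorphism $\bigoplus_{e\in\operatorname{Obj}(\mathcal{C})}\mathcal{C}^+(e,d)\otimes_k\mathcal{C}^-(c,e)\cong\mathcal{C}(c,d)$. These data are fixed. A left (resp. right) $\mathcal{C}$-module is a $k$-linear functor $\mathcal{C}\to\mathcal{K}$ (resp. $\mathcal{C}^{\mathrm{o}}\to\mathcal{K}$). $\operatorname{Hom}_{\mathcal{C}}$, $\operatorname{End}_{\mathcal{C}}$ and $\operatorname{Ext}^n_{\mathcal{C}}$ are taken in the abelian category of left $\mathcal{C}$-modules. For a right module $G$ and a left module $F$, $G\otimes_{\mathcal{C}}F$ is the quotient of $\bigoplus_{c}G(c)\otimes_kF(c)$ by the subspace generated by all $G(r)(x)\otimes y-x\otimes F(r)(y)$ for $r\colon a\to b$, $x\in G(b)$, $y\in F(a)$; $\operatorname{Tor}^{\mathcal{C}}_n$ are its left derived functors. For an ordinal $\alpha\le\lambda$ and objects $c,d$, let $\mathcal{I}^{\mathcal{C}}_{<\alpha}(c,d)\subseteq\mathcal{C}(c,d)$ be the image of the composition map $\bigoplus_{\deg(e)<\alpha}\mathcal{C}^+(e,d)\otimes_k\mathcal{C}^-(c,e)\to\mathcal{C}(c,d)$; this defines a two-sided ideal of $\mathcal{C}$. For an object $c$ of degree $\alpha$, the standard left $\mathcal{C}$-module of $c$ is $\Delta_c:=\mathcal{C}(c,-)/\mathcal{I}^{\mathcal{C}}_{<\alpha}(c,-)$ and the standard right $\mathcal{C}$-module of $c$ is $\Delta^c:=\mathcal{C}(-,c)/\mathcal{I}^{\mathcal{C}}_{<\alpha}(-,c)$.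 *)

(* Defs.v *)
From HB Require Import structures.
From mathcomp Require Import all_boot all_order all_algebra.
From mathcomp Require Import generic_quotient ring_quotient.
From mathcomp Require Import finmap.
From mathcomp Require Import boolp classical_sets functions cardinality fsbigop.

Set Implicit Arguments.
Unset Strict Implicit.
Unset Printing Implicit Defensive.

Import Order.TTheory GRing.Theory.
Import Quotient.

Local Open Scope classical_set_scope.
Local Open Scope ring_scope.
Local Open Scope quotient_scope.

Definition mklin (k : fieldType) (U V : lmodType k) (f : U -> V)
  (fL : linear f) : {linear U -> V} :=
  HB.pack f (GRing.isLinear.Build k U V *:%R f fL).

Definition nonzero (k : fieldType) (V : lmodType k) : Prop :=
  exists x : V, x != 0.

Definition lin_iso (k : fieldType) (U V : lmodType k) : Prop :=
  exists f : {linear U -> V}, bijective f.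

(* The k-algebra structure of A is passed explicitly as (one, mul). *)
Definition alg_iso_base (k : fieldType) (A : lmodType k)
    (one : A) (mul : A -> A -> A) : Prop :=
  exists f : {linear k^o -> A},
    [/\ bijective f, f 1 = one & forall x y : k, f (x * y) = mul (f x) (f y)].

Record subspace (k : fieldType) (V : lmodType k) := Subspace {
  sp_set :> V -> Prop;
  sp_0 : sp_set 0;
  sp_lin : forall (a : k) (u v : V),
    sp_set u -> sp_set v -> sp_set (a *: u + v)
}.

Section SubspaceTheory.
Variables (k : fieldType) (V : lmodType k) (S : subspace V).

Lemma sp_D u v : S u -> S v -> S (u + v).
Proof. by move=> Su Sv; rewrite -[u]scale1r; exact: sp_lin. Qed.

Lemma sp_Z a u : S u -> S (a *: u).
Proof. by move=> Su; rewrite -[_ *: _]addr0; apply: sp_lin => //; exact: sp_0. Qed.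

Lemma sp_B u v : S u -> S v -> S (u - v).
Proof. by move=> Su Sv; rewrite addrC -scaleN1r; exact: sp_lin. Qed.

Definition sp_pred : {pred V} := fun v => `[< S v >].

Lemma sp_predP v : reflect (S v) (v \in sp_pred).
Proof. exact: asboolP. Qed.

Lemma sp_pred_submod : submod_closed sp_pred.
Proof.
split; first by apply/sp_predP; exact: sp_0.
by move=> a u v /sp_predP Su /sp_predP Sv; apply/sp_predP; exact: sp_lin.
Qed.
HB.instance Definition _ := GRing.isSubmodClosed.Build k V sp_pred sp_pred_submod.

Record sub_of := SubOf { sub_val : V; _ : sub_val \in sp_pred }.
HB.instance Definition _ := [isSub for sub_val].
HB.instance Definition _ := [Choice of sub_of by <:].
HB.instance Definition _ := [SubChoice_isSubLmodule of sub_of by <:].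

Definition mksub (v : V) (Sv : S v) : sub_of := SubOf (introT (sp_predP v) Sv).

Lemma sub_valP (x : sub_of) : S (sub_val x).
Proof. by apply/sp_predP; exact: (valP x). Qed.

Lemma sub_val_linear : linear sub_val. Proof. by []. Qed.
HB.instance Definition _ :=
  GRing.isLinear.Build k sub_of V *:%R sub_val sub_val_linear.

Lemma sub_val_inj : injective sub_val. Proof. exact: val_inj. Qed.

Definition quot_of := {quot sp_pred}.
HB.instance Definition _ := GRing.Zmodule.on quot_of.

Definition proj (v : V) : quot_of := \pi_{quot sp_pred} v.

Lemma proj_eq u v : proj u = proj v <-> S (u - v).
Proof.
rewrite /proj; split=> [/eqP|Suv]; last by apply/eqP; rewrite -idealrBE; apply/sp_predP.
by rewrite -idealrBE => /sp_predP.
Qed.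

Lemma projK (x : quot_of) : proj (repr x) = x.
Proof. exact: reprK. Qed.

Lemma projD u v : proj (u + v) = proj u + proj v.
Proof. by rewrite /proj !piE. Qed.

Definition quot_scale (a : k) (x : quot_of) : quot_of := proj (a *: repr x).

Lemma quot_scale_proj a v : quot_scale a (proj v) = proj (a *: v).
Proof. by apply/proj_eq; rewrite -scalerBr; apply: sp_Z; apply/proj_eq; rewrite projK. Qed.

Lemma quot_scaleA a b x : quot_scale a (quot_scale b x) = quot_scale (a * b) x.
Proof. by rewrite -[x]projK !quot_scale_proj scalerA. Qed.

Lemma quot_scale1 : left_id 1 quot_scale.
Proof. by move=> x; rewrite -[x]projK quot_scale_proj scale1r. Qed.

Lemma quot_scaleDr : right_distributive quot_scale +%R.
Proof.
move=> a x y; rewrite -[x]projK -[y]projK -projD !quot_scale_proj.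
by rewrite scalerDr projD.
Qed.

Lemma quot_scaleDl x : {morph quot_scale^~ x : a b / a + b}.
Proof. by move=> a b; rewrite -[x]projK !quot_scale_proj scalerDl projD. Qed.

HB.instance Definition _ := GRing.Zmodule_isLmodule.Build k quot_of
  quot_scaleA quot_scale1 quot_scaleDr quot_scaleDl.

Lemma proj_linear : linear proj.
Proof. by move=> a u v; rewrite projD -quot_scale_proj. Qed.
HB.instance Definition _ :=
  GRing.isLinear.Build k V quot_of *:%R proj proj_linear.

Lemma proj_eq0 v : proj v = 0 <-> S v.
Proof. by rewrite -[0](linear0 proj) proj_eq subr0. Qed.

Variables (W : lmodType k) (f : {linear V -> W}) (f0 : forall v, S v -> f v = 0).

Definition quot_lift_fun (x : quot_of) : W := f (repr x).

Lemma quot_lift_funE v : quot_lift_fun (proj v) = f v.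
Proof.
by apply/eqP; rewrite -subr_eq0 -linearB; apply/eqP/f0/proj_eq; rewrite projK.
Qed.

Lemma quot_lift_linear : linear quot_lift_fun.
Proof.
move=> a x y; rewrite -[x]projK -[y]projK -linearP !quot_lift_funE.
by rewrite linearP.
Qed.

Definition quot_lift : {linear quot_of -> W} := mklin quot_lift_linear.

Lemma quot_liftE v : quot_lift (proj v) = f v.
Proof. exact: quot_lift_funE. Qed.

End SubspaceTheory.

Section MoreSubspaces.
Variables (k : fieldType) (V : lmodType k).

Lemma span0 (A : set V) :
  [set v | forall S : subspace V, A `<=` S -> S v] 0.
Proof. by move=> S _; exact: sp_0. Qed.

Lemma spanP (A : set V) (a : k) (u v : V) :
  [set v | forall S : subspace V, A `<=` S -> S v] u ->
  [set v | forall S : subspace V, A `<=` S -> S v] v ->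
  [set v | forall S : subspace V, A `<=` S -> S v] (a *: u + v).
Proof. by move=> Su Sv S AS; apply: sp_lin; [exact: Su|exact: Sv]. Qed.

Definition span (A : set V) : subspace V := Subspace (@span0 A) (@spanP A).

Lemma span_gen (A : set V) v : A v -> span A v.
Proof. by move=> Av S; apply. Qed.

Lemma span_sub (A : set V) (S : subspace V) : A `<=` S -> span A `<=` S.
Proof. by move=> AS v; apply. Qed.

Variables (W : lmodType k) (f : {linear V -> W}).

Lemma ker0 : [set v | f v = 0] 0.
Proof. exact: linear0. Qed.

Lemma kerP (a : k) (u v : V) :
  [set v | f v = 0] u -> [set v | f v = 0] v -> [set v | f v = 0] (a *: u + v).
Proof. by rewrite /= linearP => -> ->; rewrite scaler0 addr0. Qed.

Definition ker : subspace V := Subspace ker0 kerP.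

Lemma im0 : [set w | exists v, f v = w] 0.
Proof. by exists 0; exact: linear0. Qed.

Lemma imP (a : k) (u v : W) :
  [set w | exists v, f v = w] u -> [set w | exists v, f v = w] v ->
  [set w | exists v, f v = w] (a *: u + v).
Proof. by move=> [x <-] [y <-]; exists (a *: x + y); exact: linearP. Qed.

Definition im : subspace W := Subspace im0 imP.

Variable S : subspace W.

Lemma preim0 : [set v | S (f v)] 0.
Proof. by rewrite /= linear0; exact: sp_0. Qed.

Lemma preimP (a : k) (u v : V) :
  [set v | S (f v)] u -> [set v | S (f v)] v -> [set v | S (f v)] (a *: u + v).
Proof. by rewrite /= linearP; exact: sp_lin. Qed.

Definition preim_sp : subspace V := Subspace preim0 preimP.

End MoreSubspaces.

(* ker g / (ker g `&` im f); it is only used when g \o f = 0. *)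
Definition homology (k : fieldType) (U V W : lmodType k)
    (f : {linear U -> V}) (g : {linear V -> W}) : lmodType k :=
  quot_of (preim_sp (sub_val (S := ker g)) (im f)).

Section DepProd.
Variables (k : fieldType) (I : Type) (V : I -> lmodType k).

Definition dprod := forall i, V i.
HB.instance Definition _ := Choice.copy dprod (forall i, V i).

Definition dprod_zero : dprod := fun i => 0.
Definition dprod_opp (f : dprod) : dprod := fun i => - f i.
Definition dprod_add (f g : dprod) : dprod := fun i => f i + g i.
Definition dprod_scale (a : k) (f : dprod) : dprod := fun i => a *: f i.

Lemma dprod_addA : associative dprod_add.
Proof. by move=> f g h; apply/functional_extensionality_dep => i; exact: addrA. Qed.
Lemma dprod_addC : commutative dprod_add.
Proof. by move=> f g; apply/functional_extensionality_dep => i; exact: addrC. Qed.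
Lemma dprod_add0 : left_id dprod_zero dprod_add.
Proof. by move=> f; apply/functional_extensionality_dep => i; exact: add0r. Qed.
Lemma dprod_addN : left_inverse dprod_zero dprod_opp dprod_add.
Proof. by move=> f; apply/functional_extensionality_dep => i; exact: addNr. Qed.
HB.instance Definition _ :=
  GRing.isZmodule.Build dprod dprod_addA dprod_addC dprod_add0 dprod_addN.

Lemma dprod_scaleA a b f : dprod_scale a (dprod_scale b f) = dprod_scale (a * b) f.
Proof. by apply/functional_extensionality_dep => i; exact: scalerA. Qed.
Lemma dprod_scale1 : left_id 1 dprod_scale.
Proof. by move=> f; apply/functional_extensionality_dep => i; exact: scale1r. Qed.
Lemma dprod_scaleDr : right_distributive dprod_scale +%R.
Proof. by move=> a f g; apply/functional_extensionality_dep => i; exact: scalerDr. Qed.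
Lemma dprod_scaleDl f : {morph dprod_scale^~ f : a b / a + b}.
Proof. by move=> a b; apply/functional_extensionality_dep => i; exact: scalerDl. Qed.
HB.instance Definition _ := GRing.Zmodule_isLmodule.Build k dprod
  dprod_scaleA dprod_scale1 dprod_scaleDr dprod_scaleDl.

End DepProd.

Section DirectSum.
Variables (k : fieldType) (I : Type) (V : I -> lmodType k).

Lemma finsupp0 : [set f : dprod V | finite_set [set i | f i != 0]] 0.
Proof.
apply: (sub_finite_set _ (finite_set0 I)) => i /=.
by rewrite [(0 : dprod V) i](_ : _ = 0) ?eqxx.
Qed.

Lemma finsuppP (a : k) (u v : dprod V) :
  [set f : dprod V | finite_set [set i | f i != 0]] u ->
  [set f : dprod V | finite_set [set i | f i != 0]] v ->
  [set f : dprod V | finite_set [set i | f i != 0]] (a *: u + v).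
Proof.
move=> fu fv.
have : finite_set ([set i | u i != 0] `|` [set i | v i != 0]).
  by rewrite finite_setU; split; [exact: fu|exact: fv].
apply: sub_finite_set.
move=> i /=; rewrite [(a *: u + v) i](_ : _ = a *: u i + v i) //.
case: (eqVneq (u i) 0) => [->|]; last by left.
by rewrite scaler0 add0r; right.
Qed.

Definition dsum : lmodType k := sub_of (Subspace finsupp0 finsuppP).

Definition coord (f : dsum) : dprod V := sub_val f.

Lemma coordP (f g : dsum) : (forall i, coord f i = coord g i) -> f = g.
Proof. by move=> fg; apply/sub_val_inj/functional_extensionality_dep. Qed.

Lemma coord_linear i : linear (fun f : dsum => coord f i).
Proof. by []. Qed.

Lemma coordE (a : k) (f g : dsum) i :
  coord (a *: f + g) i = a *: coord f i + coord g i.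
Proof. by []. Qed.

Definition dsum_in_fun (i : I) (v : V i) : dprod V := fun j =>
  if pselect (i = j) is left e then eq_rect i V v j e else 0.

Lemma dsum_in_funE i v : dsum_in_fun v i = v.
Proof.
rewrite /dsum_in_fun; case: pselect => // e.
by rewrite (Prop_irrelevance e erefl).
Qed.

Lemma dsum_in_funN i j v : i <> j -> @dsum_in_fun i v j = 0.
Proof. by rewrite /dsum_in_fun; case: pselect. Qed.

Lemma dsum_in_finsupp i v : finite_set [set j | @dsum_in_fun i v j != 0].
Proof.
apply: sub_finite_set (finite_set1 i) => j /=.
by apply: contra_neqP => ij; apply: dsum_in_funN => /esym.
Qed.

Lemma dsum_in_linear i :
  linear (fun v : V i => @mksub _ _ (Subspace finsupp0 finsuppP) _ (dsum_in_finsupp v)).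
Proof.
move=> a u v; apply: coordP => j; rewrite coordE /coord /=.
have [<-{j}|ij] := pselect (i = j); first by rewrite !dsum_in_funE.
by rewrite !dsum_in_funN // scaler0 addr0.
Qed.

Definition dsum_in (i : I) : {linear V i -> dsum} := mklin (@dsum_in_linear i).

Lemma coord_in i v : coord (dsum_in i v) i = v.
Proof. exact: dsum_in_funE. Qed.

Lemma coord_inN i j v : i <> j -> coord (dsum_in i v) j = 0.
Proof. exact: dsum_in_funN. Qed.

Section Lift.
Variables (W : lmodType k) (phi : forall i, {linear V i -> W}).

Definition dsum_lift_fun (f : dsum) : W :=
  \sum_(i \in [set: {classic I}]) phi i (coord f i).

Lemma dsum_lift_seq (f : dsum) (r : seq {classic I}) : uniq r ->
  (forall i : {classic I}, i \notin r -> coord f i = 0) ->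
  dsum_lift_fun f = \sum_(i <- r) phi i (coord f i).
Proof.
move=> ru r0; rewrite /dsum_lift_fun (fsbigE r) //; first last.
  by move=> i _ /r0 ->; rewrite linear0.
by apply: eq_bigl => i; rewrite in_setT.
Qed.

Lemma dsum_supp (f : dsum) : exists2 r : seq {classic I}, uniq r &
  forall i : {classic I}, i \notin r -> coord f i = 0.
Proof.
have /finite_fsetP[X fX] : finite_set [set i : {classic I} | coord f i != 0].
  exact: (sub_valP f).
exists (enum_fset X) => [|i iX]; first exact: fset_uniq.
apply/eqP; apply: contraNT iX => fi.
by have : [set i : {classic I} | coord f i != 0] i by []; rewrite fX.
Qed.

Lemma dsum_lift_linear : linear dsum_lift_fun.
Proof.
move=> a f g; have [r ru r0] := dsum_supp f; have [s su s0] := dsum_supp g.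
have f0 (i : {classic I}) : i \notin undup (r ++ s) -> coord f i = 0.
  by rewrite mem_undup mem_cat => /norP[/r0].
have g0 (i : {classic I}) : i \notin undup (r ++ s) -> coord g i = 0.
  by rewrite mem_undup mem_cat => /norP[_ /s0].
have fg0 (i : {classic I}) : i \notin undup (r ++ s) -> coord (a *: f + g) i = 0.
  by move=> iX; rewrite coordE f0 // g0 // scaler0 addr0.
rewrite (dsum_lift_seq _ fg0) ?undup_uniq // (dsum_lift_seq _ f0) ?undup_uniq //.
rewrite (dsum_lift_seq _ g0) ?undup_uniq //.
rewrite scaler_sumr -big_split; apply: eq_bigr => i _.
exact: (linearP (phi i)).
Qed.

Definition dsum_lift : {linear dsum -> W} := mklin dsum_lift_linear.

Lemma dsum_liftE i v : dsum_lift (dsum_in i v) = phi i v.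
Proof.
rewrite [LHS](@dsum_lift_seq _ [:: i : {classic I}]) //.
  by rewrite big_seq1 coord_in.
by move=> j; rewrite inE => /eqP ji; rewrite coord_inN // => /esym.
Qed.

End Lift.

Lemma dsum_decomp (f : dsum) : exists r : seq {classic I},
  f = \sum_(i <- r) dsum_in i (coord f i).
Proof.
have [r ru r0] := dsum_supp f; exists r; apply: coordP => j.
pose c : {linear dsum -> V j} := mklin (coord_linear j).
have -> : coord (\sum_(i <- r) dsum_in i (coord f i)) j =
  \sum_(i <- r) coord (dsum_in i (coord f i)) j by exact: (linear_sum c).
have [jr|jr] := boolP ((j : {classic I}) \in r); last first.
  rewrite (r0 _ jr) big_seq big1 // => i ir; apply: coord_inN => ij.
  by move: jr; rewrite -ij ir.
rewrite (bigD1_seq (j : {classic I})) // coord_in big1 => [|i /eqP ij].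
  by rewrite [RHS]addr0.
exact: coord_inN.
Qed.

Lemma dsum_ind (S : subspace dsum) :
  (forall i v, S (dsum_in i v)) -> forall f, S f.
Proof.
move=> Sin f; have [r ->] := dsum_decomp f.
by elim/big_ind: _ => //; [exact: sp_0|exact: sp_D].
Qed.

Lemma dsum_ext (W : lmodType k) (f g : {linear dsum -> W}) :
  (forall i v, f (dsum_in i v) = g (dsum_in i v)) -> forall z, f z = g z.
Proof.
move=> fg z.
suff : ker (f \- g) z by move=> /= /eqP; rewrite subr_eq0 => /eqP.
apply: dsum_ind => i v.
by change (f (dsum_in i v) - g (dsum_in i v) = 0); rewrite fg subrr.
Qed.

End DirectSum.

Section DirectSumMap.
Variables (k : fieldType) (I : Type) (V W : I -> lmodType k).
Variable phi : forall i, {linear V i -> W i}.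

Definition dsum_map : {linear dsum V -> dsum W} :=
  dsum_lift (fun i => dsum_in W i \o phi i : {linear V i -> dsum W}).

Lemma dsum_map_in i v : dsum_map (dsum_in V i v) = dsum_in W i (phi i v).
Proof. exact: dsum_liftE. Qed.

Lemma coord_map f i : coord (dsum_map f) i = phi i (coord f i).
Proof.
pose F : {linear dsum V -> W i} := mklin (coord_linear (V := W) i) \o dsum_map.
pose G : {linear dsum V -> W i} := phi i \o mklin (coord_linear (V := V) i).
apply: (dsum_ext (f := F) (g := G)) => j v.
change (coord (dsum_map (dsum_in V j v)) i = phi i (coord (dsum_in V j v) i)).
rewrite dsum_map_in; have [e|ij] := pselect (j = i).
  by case: i / e F G => _ _; rewrite !coord_in.
by rewrite !coord_inN // linear0.
Qed.

End DirectSumMap.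

Section Tensor.
Variables (k : fieldType) (V W : lmodType k).

Definition free_space (T : Type) : lmodType k := dsum (fun _ : T => k^o : lmodType k).

Definition gen (T : Type) (t : T) : free_space T :=
  dsum_in (fun _ : T => k^o : lmodType k) t 1.

Definition bilinear_rel : set (free_space (V * W)) := [set z |
  (exists (a : k) (v v' : V) (w : W),
     z = gen (a *: v + v', w) - (a *: gen (v, w) + gen (v', w))) \/
  (exists (a : k) (v : V) (w w' : W),
     z = gen (v, a *: w + w') - (a *: gen (v, w) + gen (v, w')))].

Definition tensor : lmodType k := quot_of (span bilinear_rel).

Definition tens (v : V) (w : W) : tensor := proj (span bilinear_rel) (gen (v, w)).

Lemma tens_linearl w : linear (tens^~ w).
Proof.
move=> a v v'; rewrite /tens -linearP; apply/proj_eq/span_gen; left.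
by exists a, v, v', w.
Qed.

Lemma tens_linearr v : linear (tens v).
Proof.
move=> a w w'; rewrite /tens -linearP; apply/proj_eq/span_gen; right.
by exists a, v, w, w'.
Qed.

Lemma free_ind T (S : subspace (free_space T)) :
  (forall t, S (gen t)) -> forall z, S z.
Proof.
move=> Sgen; apply: dsum_ind => t a.
rewrite -[a]mulr1 -[_ * _]/(a *: (1 : k^o)) linearZ.
by apply: sp_Z; exact: Sgen.
Qed.

Lemma tens_ind (S : subspace tensor) :
  (forall v w, S (tens v w)) -> forall z, S z.
Proof.
move=> St z; rewrite -[z]projK.
have : forall y, preim_sp (proj (span bilinear_rel)) S y.
  by apply: free_ind => -[v w]; exact: St.
exact.
Qed.

Lemma tens_ext (U : lmodType k) (f g : {linear tensor -> U}) :
  (forall v w, f (tens v w) = g (tens v w)) -> forall z, f z = g z.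
Proof.
move=> fg z.
suff : ker (f \- g) z by move=> /= /eqP; rewrite subr_eq0 => /eqP.
apply: tens_ind => v w.
by change (f (tens v w) - g (tens v w) = 0); rewrite fg subrr.
Qed.

Section Lift.
Variables (U : lmodType k) (b : V -> W -> U).
Hypotheses (bl : forall w, linear (b^~ w)) (br : forall v, linear (b v)).

Lemma scale_at_linear (u : U) : linear (fun a : k^o => a *: u).
Proof. by move=> a x y; rewrite scalerDl scalerA. Qed.

Definition free_lift (T : Type) (h : T -> U) : {linear free_space T -> U} :=
  dsum_lift (fun t => mklin (scale_at_linear (h t))).

Lemma free_liftE T (h : T -> U) t : free_lift h (gen t) = h t.
Proof. by rewrite [LHS]dsum_liftE /= scale1r. Qed.

Lemma tensor_lift_subproof z :
  span bilinear_rel z -> free_lift (fun p => b p.1 p.2) z = 0.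
Proof.
move: z; apply: (@span_sub _ _ _ (ker (free_lift (fun p => b p.1 p.2)))).
move=> _ [] [a [x [y [z ->]]]].
  change (free_lift (fun p => b p.1 p.2)
    (gen (a *: x + y, z) - (a *: gen (x, z) + gen (y, z))) = 0).
  by rewrite linearB linearP !free_liftE /= bl subrr.
change (free_lift (fun p => b p.1 p.2)
  (gen (x, a *: y + z) - (a *: gen (x, y) + gen (x, z))) = 0).
by rewrite linearB linearP !free_liftE /= br subrr.
Qed.

Definition tensor_lift : {linear tensor -> U} := quot_lift tensor_lift_subproof.

Lemma tensor_liftE v w : tensor_lift (tens v w) = b v w.
Proof. by rewrite [LHS]quot_liftE free_liftE. Qed.

End Lift.

End Tensor.

Record klinCat (k : fieldType) := KlinCat {
  obj :> Type;
  hom : obj -> obj -> lmodType k;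
  idm : forall c, hom c c;
  comp : forall a b c, hom b c -> hom a b -> hom a c;
  comp_linl : forall a b c (f : hom a b), linear (fun g : hom b c => comp g f);
  comp_linr : forall a b c (g : hom b c), linear (fun f : hom a b => comp g f);
  compA : forall a b c d (h : hom c d) (g : hom b c) (f : hom a b),
    comp h (comp g f) = comp (comp h g) f;
  comp1m : forall a b (f : hom a b), comp (idm b) f = f;
  compm1 : forall a b (f : hom a b), comp f (idm a) = f
}.
Arguments hom {k} C a b : rename.
Arguments idm {k C} c : rename.
Arguments comp {k C a b c} g f : rename.

Definition opcat (k : fieldType) (C : klinCat k) : klinCat k :=
  @KlinCat k C (fun a b => hom C b a) (fun c => idm c)
    (fun a b c g f => comp f g)
    (fun a b c f => @comp_linr k C _ _ _ f)
    (fun a b c g => @comp_linl k C _ _ _ g)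
    (fun a b c d h g f => esym (compA f g h))
    (fun a b f => compm1 f)
    (fun a b f => comp1m f).

(* A left C-module; a right C-module is a cmodule over opcat C. *)
Record cmodule (k : fieldType) (C : klinCat k) := CModule {
  mob :> C -> lmodType k;
  act : forall a b, hom C a b -> mob a -> mob b;
  act_linl : forall a b (x : mob a), linear (fun r : hom C a b => act r x);
  act_linr : forall a b (r : hom C a b), linear (act r);
  act1 : forall a (x : mob a), act (idm a) x = x;
  actM : forall a b c (s : hom C b c) (r : hom C a b) (x : mob a),
    act (comp s r) x = act s (act r x)
}.
Arguments act {k C} M {a b} r x : rename.

Section Modules.
Variables (k : fieldType) (C : klinCat k).

HB.instance Definition _ (M : cmodule C) a b (r : hom C a b) :=
  GRing.isLinear.Build k (M a) (M b) *:%R (act M r) (@act_linr _ _ M a b r).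

Section Hom.
Variables M N : cmodule C.

Definition families : lmodType k :=
  dprod (fun c => dprod (fun _ : M c => N c) : lmodType k).

Definition is_modhom (f : forall c, M c -> N c) : Prop :=
  (forall c, linear (f c)) /\
  (forall a b (r : hom C a b) (x : M a), f b (act M r x) = act N r (f a x)).

Lemma modhom0 : @is_modhom (0 : families).
Proof.
split=> [c a x y|a b r x]; last by rewrite [RHS]linear0.
by rewrite [RHS]addr0 [RHS]scaler0.
Qed.

Lemma modhomP (a : k) (f g : families) :
  is_modhom f -> is_modhom g -> @is_modhom (a *: f + g : families).
Proof.
move=> [fL fN] [gL gN]; split=> [c b x y|c d r x].
  change (a *: f c (b *: x + y) + g c (b *: x + y) =
    b *: (a *: f c x + g c x) + (a *: f c y + g c y)).
  by rewrite fL gL !scalerDr !scalerA [b * a]mulrC addrACA.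
change (a *: f d (act M r x) + g d (act M r x) =
  act N r (a *: f c x + g c x)).
by rewrite linearP fN gN.
Qed.

Definition modhom : lmodType k :=
  sub_of (@Subspace k families is_modhom modhom0 modhomP).

Definition mkmodhom (f : forall c, M c -> N c) (fP : is_modhom f) : modhom :=
  @mksub k families (@Subspace k families is_modhom modhom0 modhomP) f fP.

Definition mapp (f : modhom) (c : C) : M c -> N c := sub_val f c.

Lemma mapp_linear f c : linear (@mapp f c).
Proof. by have [fL _] := sub_valP f; exact: fL. Qed.
HB.instance Definition _ f c :=
  GRing.isLinear.Build k (M c) (N c) *:%R (@mapp f c) (@mapp_linear f c).

Lemma mappN f a b (r : hom C a b) x :
  mapp f (act M r x) = act N r (mapp f x).
Proof. by have [_ fN] := sub_valP f; exact: fN. Qed.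

Lemma modhom_ext (f g : modhom) : (forall c x, @mapp f c x = mapp g x) -> f = g.
Proof.
move=> fg; apply/sub_val_inj/functional_extensionality_dep => c.
by apply/functional_extensionality_dep => x; exact: fg.
Qed.

End Hom.

Lemma id_is_modhom (M : cmodule C) : @is_modhom M M (fun c x => x).
Proof. by []. Qed.

Definition modid (M : cmodule C) : modhom M M := mkmodhom (id_is_modhom M).

Lemma comp_is_modhom (M N P : cmodule C) (g : modhom N P) (f : modhom M N) :
  @is_modhom M P (fun c x => mapp g (mapp f x)).
Proof.
by split=> [c a x y|a b r x]; [rewrite !linearP|rewrite !mappN].
Qed.

Definition modcomp (M N P : cmodule C) (g : modhom N P) (f : modhom M N) :
  modhom M P := mkmodhom (comp_is_modhom g f).

Lemma modcomp_linearl (M N P : cmodule C) (f : modhom M N) :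
  linear (fun g : modhom N P => modcomp g f).
Proof. by move=> a g h; exact: modhom_ext. Qed.

Definition precomp (M N P : cmodule C) (f : modhom M N) :
  {linear modhom N P -> modhom M P} := mklin (@modcomp_linearl M N P f).

Definition surjective_hom (M N : cmodule C) (g : modhom M N) : Prop :=
  forall c (y : N c), exists x : M c, mapp g x = y.

(* Epimorphisms of C-modules are the objectwise surjective ones. *)
Definition projective (P : cmodule C) : Prop :=
  forall (M N : cmodule C) (g : modhom M N), surjective_hom g ->
  forall f : modhom P N, exists h : modhom P M, modcomp g h = f.

Definition repr_mod (c : C) : cmodule C :=
  @CModule k C (fun d => hom C c d) (fun a b r x => comp r x)
    (fun a b x => comp_linl x) (fun a b r => comp_linr r)
    (fun a x => comp1m x) (fun a b d s r x => esym (compA s r x)).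

Record submodule (M : cmodule C) := Submodule {
  sm_sp :> forall c, subspace (M c);
  sm_act : forall a b (r : hom C a b) (x : M a),
    sm_sp a x -> sm_sp b (act M r x)
}.

Section SubQuot.
Variables (M : cmodule C) (S : submodule M).

Definition submod_act a b (r : hom C a b) (x : sub_of (S a)) : sub_of (S b) :=
  mksub (sm_act r (sub_valP x)).

Definition submod : cmodule C.
Proof.
refine (@CModule k C (fun c => sub_of (S c)) submod_act _ _ _ _).
- by move=> a b x t r s; apply: sub_val_inj; exact: (act_linl (sub_val x)).
- by move=> a b r t x y; apply: sub_val_inj; exact: (act_linr r).
- by move=> a x; apply: sub_val_inj; exact: act1.
- by move=> a b c s r x; apply: sub_val_inj; exact: actM.
Defined.

Lemma quotmod_act_subproof a b (r : hom C a b) x :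
  S a x -> (proj (S b) \o act M r : {linear M a -> quot_of (S b)}) x = 0.
Proof. by move=> Sx; apply/proj_eq0/sm_act. Qed.

Definition quotmod_act a b (r : hom C a b) :
  {linear quot_of (S a) -> quot_of (S b)} :=
  quot_lift (@quotmod_act_subproof a b r).

Lemma quotmod_actE a b (r : hom C a b) x :
  quotmod_act r (proj (S a) x) = proj (S b) (act M r x).
Proof. exact: quot_liftE. Qed.

Definition quotmod : cmodule C.
Proof.
refine (@CModule k C (fun c => quot_of (S c)) (fun a b r x => quotmod_act r x)
  _ _ _ _).
- move=> a b x t r s; rewrite -[x]projK !quotmod_actE -linearP.
  by congr proj; exact: (act_linl (repr x)).
- by move=> a b r t x y; rewrite linearP.
- by move=> a x; rewrite -[x]projK quotmod_actE act1.
- by move=> a b c s r x; rewrite -[x]projK !quotmod_actE actM.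
Defined.

End SubQuot.

Section KerMod.
Variables (M N : cmodule C) (f : modhom M N).

Lemma kermod_subproof a b (r : hom C a b) (x : M a) :
  ker (@mapp M N f a) x -> ker (@mapp M N f b) (act M r x).
Proof. by rewrite /= mappN => ->; rewrite linear0. Qed.

Definition kermod : cmodule C :=
  submod (@Submodule M (fun c => ker (@mapp M N f c)) kermod_subproof).

Lemma kerincl_is_modhom : @is_modhom kermod M (fun c x => sub_val x).
Proof. by []. Qed.

Definition kerincl : modhom kermod M := mkmodhom kerincl_is_modhom.

End KerMod.

Section SumMod.
Variables (I : Type) (Ms : I -> cmodule C).

Definition summod_act a b (r : hom C a b) :
    {linear dsum (fun i => Ms i a) -> dsum (fun i => Ms i b)} :=
  dsum_map (fun i => act (Ms i) r : {linear Ms i a -> Ms i b}).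

Lemma summod_act_coord a b (r : hom C a b) f i :
  coord (summod_act r f) i = act (Ms i) r (coord f i).
Proof.
exact: coord_map.
Qed.

Definition summod : cmodule C.
Proof.
refine (@CModule k C (fun c => dsum (fun i => Ms i c))
  (fun a b r x => summod_act r x) _ _ _ _).
- move=> a b x t r s; apply: coordP => i; rewrite coordE !summod_act_coord.
  exact: act_linl.
- by move=> a b r t x y; rewrite linearP.
- by move=> a x; apply: coordP => i; rewrite summod_act_coord act1.
- by move=> a b c s r x; apply: coordP => i; rewrite !summod_act_coord actM.
Defined.

Variables (N : cmodule C) (phi : forall i, modhom (Ms i) N).

Definition summod_lift_fun (c : C) : {linear summod c -> N c} :=
  dsum_lift (fun i => @mapp (Ms i) N (phi i) c : {linear Ms i c -> N c}).

Lemma summod_lift_is_modhom : @is_modhom summod N (fun c x => summod_lift_fun c x).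
Proof.
split=> [c t x y|a b r]; first by rewrite linearP.
pose F : {linear summod a -> N b} := summod_lift_fun b \o act summod r.
pose G : {linear summod a -> N b} := act N r \o summod_lift_fun a.
apply: (dsum_ext (f := F) (g := G)) => i v.
change (summod_lift_fun b (summod_act r (dsum_in (fun i => Ms i a) i v)) =
  act N r (summod_lift_fun a (dsum_in (fun i => Ms i a) i v))).
by rewrite [summod_act _ _]dsum_map_in !dsum_liftE; exact: mappN.
Qed.

Definition summod_lift : modhom summod N := mkmodhom summod_lift_is_modhom.

Lemma summod_liftE c i (v : Ms i c) :
  mapp summod_lift (dsum_in (fun i => Ms i c) i v) = mapp (phi i) v.
Proof. exact: dsum_liftE. Qed.

End SumMod.

Section Yoneda.
Variables (M : cmodule C) (c : C) (x : M c).

Lemma yoneda_is_modhom : @is_modhom (repr_mod c) M (fun d r => act M r x).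
Proof. by split=> [d|a b r s]; [exact: act_linl|exact: actM]. Qed.

Definition yoneda : modhom (repr_mod c) M := mkmodhom yoneda_is_modhom.

End Yoneda.

Definition free_mod (I : Type) (o : I -> C) : cmodule C :=
  summod (fun i => repr_mod (o i)).

Lemma free_mod_projective I (o : I -> C) : projective (free_mod o).
Proof.
move=> M N g gS f.
pose e i : free_mod o (o i) :=
  dsum_in (fun j => repr_mod (o j) (o i)) i (idm (o i)).
pose y i := sval (cid (gS _ (mapp f (e i)))).
have yP i : mapp g (y i) = mapp f (e i) by exact: (svalP (cid (gS _ (mapp f (e i))))).
pose h := summod_lift (fun i => yoneda (y i)).
exists h; apply: modhom_ext => c.
pose F1 : {linear free_mod o c -> N c} := @mapp _ _ (modcomp g h) c.
pose F2 : {linear free_mod o c -> N c} := @mapp _ _ f c.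
apply: (dsum_ext (f := F1) (g := F2)) => i r.
change (mapp g (mapp (summod_lift (fun i => yoneda (y i)))
    (dsum_in (fun j => repr_mod (o j) c) i r)) =
  mapp f (dsum_in (fun j => repr_mod (o j) c) i r)).
rewrite summod_liftE -[mapp (yoneda _) r]/(act M r (y i)) mappN yP -mappN.
suff -> : act (free_mod o) r (e i) = dsum_in (fun j => repr_mod (o j) c) i r by [].
rewrite [LHS]dsum_map_in; apply: (congr1 (dsum_in _ i)).
exact: compm1.
Qed.

Record proj_resolution (M : cmodule C) := ProjResolution {
  res_mod : nat -> cmodule C;
  res_projective : forall n, projective (res_mod n);
  res_diff : forall n, modhom (res_mod n.+1) (res_mod n);
  res_aug : modhom (res_mod 0) M;
  res_aug_surj : surjective_hom res_aug;
  res_exact0 : forall c (x : res_mod 0 c),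
    mapp res_aug x = 0 <-> exists y, mapp (res_diff 0) y = x;
  res_exactS : forall n c (x : res_mod n.+1 c),
    mapp (res_diff n) x = 0 <-> exists y, mapp (res_diff n.+1) y = x
}.

(* The free module on all elements of M, covering M. *)
Definition cover (M : cmodule C) : cmodule C :=
  free_mod (fun i : {c : C & M c} => projT1 i).

Definition cover_map (M : cmodule C) : modhom (cover M) M :=
  summod_lift (fun i : {c : C & M c} => yoneda (projT2 i)).

Lemma cover_surj M : surjective_hom (cover_map M).
Proof.
move=> c y.
exists (dsum_in (fun j : {c : C & M c} => repr_mod (projT1 j) c)
  (existT _ c y) (idm c)).
by rewrite summod_liftE; exact: act1.
Qed.

Fixpoint syzygy (M : cmodule C) (n : nat) : cmodule C :=
  if n is n'.+1 then kermod (cover_map (syzygy M n')) else M.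

Definition free_diff (M : cmodule C) (n : nat) :
    modhom (cover (syzygy M n.+1)) (cover (syzygy M n)) :=
  modcomp (kerincl (cover_map (syzygy M n))) (cover_map (syzygy M n.+1)).

Lemma free_exact M n c (x : cover (syzygy M n) c) :
  mapp (cover_map (syzygy M n)) x = 0 <->
  exists y, mapp (free_diff M n) y = x.
Proof.
split=> [x0|[y <-]]; last exact: (sub_valP (mapp (cover_map (syzygy M n.+1)) y)).
have [y yP] := @cover_surj (syzygy M n.+1) c
  (@mksub _ _ (ker (@mapp _ _ (cover_map (syzygy M n)) c)) x x0).
by exists y; rewrite -[LHS]/(sub_val (mapp (cover_map (syzygy M n.+1)) y)) yP.
Qed.

Lemma free_exactS M n c (x : cover (syzygy M n.+1) c) :
  mapp (free_diff M n) x = 0 <-> exists y, mapp (free_diff M n.+1) y = x.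
Proof.
rewrite -free_exact; split=> [x0|x0]; first exact: sub_val_inj.
by rewrite -[LHS]/(sub_val (mapp (cover_map (syzygy M n.+1)) x)) x0.
Qed.

Definition free_resolution (M : cmodule C) : proj_resolution M :=
  @ProjResolution M (fun n => cover (syzygy M n))
    (fun n => @free_mod_projective _ _) (free_diff M) (cover_map M)
    (@cover_surj M) (@free_exact M 0) (@free_exactS M).

Definition Ext_of (M N : cmodule C) (P : proj_resolution M) (n : nat) :
    lmodType k :=
  if n is n'.+1 then homology (precomp N (res_diff P n'))
                              (precomp N (res_diff P n'.+1))
  else homology (\0 : {linear modhom (res_mod P 0) N -> modhom (res_mod P 0) N})
                (precomp N (res_diff P 0)).

(* Derived functors are computed from one chosen projective resolution of each
   module, as usual; another choice gives canonically isomorphic spaces. *)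
Definition Ext (n : nat) (M N : cmodule C) : lmodType k :=
  Ext_of N (free_resolution M) n.

Section TensorC.
Variable G : cmodule (opcat C).

Section Def.
Variable F : cmodule C.

Definition balanced_rel : set (dsum (fun c : C => tensor (G c) (F c))) :=
  [set z | exists (a b : C) (r : hom C a b) (x : G b) (y : F a),
    z = dsum_in (fun c : C => tensor (G c) (F c)) a
          (tens (act G (r : hom (opcat C) b a) x) y) -
        dsum_in (fun c : C => tensor (G c) (F c)) b (tens x (act F r y))].

Definition tensorC : lmodType k := quot_of (span balanced_rel).

End Def.

Section Map.
Variables (M N : cmodule C) (f : modhom M N).

Lemma tens_map_linearl c (y : M c) :
  linear (fun x : G c => tens x (mapp f y)).
Proof. exact: tens_linearl. Qed.

Lemma tens_map_linearr c (x : G c) :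
  linear (fun y : M c => tens x (mapp f y)).
Proof. by move=> a y y'; rewrite linearP; exact: tens_linearr. Qed.

Definition tens_map c : {linear tensor (G c) (M c) -> tensor (G c) (N c)} :=
  tensor_lift (@tens_map_linearl c) (@tens_map_linearr c).

Definition tens_sum_map :
    {linear dsum (fun c : C => tensor (G c) (M c)) -> tensorC N} :=
  proj (span (balanced_rel (F := N))) \o dsum_map tens_map.

Lemma tens_sum_map_in c x y :
  tens_sum_map (dsum_in (fun c : C => tensor (G c) (M c)) c (tens x y)) =
  proj (span (balanced_rel (F := N)))
    (dsum_in (fun c : C => tensor (G c) (N c)) c (tens x (mapp f y))).
Proof.
apply: (congr1 (proj (span (balanced_rel (F := N))))).
rewrite dsum_map_in; apply: (congr1 (dsum_in _ c)).
exact: tensor_liftE.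
Qed.

Lemma tens_sum_map0 z : span (balanced_rel (F := M)) z -> tens_sum_map z = 0.
Proof.
move: z; apply: (@span_sub _ _ _ (ker tens_sum_map)).
move=> _ [a [b [r [x [y ->]]]]].
apply/eqP; rewrite linearB subr_eq0 !tens_sum_map_in mappN; apply/eqP.
by apply/proj_eq/span_gen; exists a, b, r, x, (mapp f y).
Qed.

Definition tensorC_map : {linear tensorC M -> tensorC N} :=
  quot_lift tens_sum_map0.

End Map.

Definition Tor_of (F : cmodule C) (P : proj_resolution F) (n : nat) :
    lmodType k :=
  if n is n'.+1 then homology (tensorC_map (res_diff P n'.+1))
                              (tensorC_map (res_diff P n'))
  else homology (tensorC_map (res_diff P 0))
         (\0 : {linear tensorC (res_mod P 0) -> tensorC (res_mod P 0)}).

Definition Tor (n : nat) (F : cmodule C) : lmodType k :=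
  Tor_of (free_resolution F) n.

End TensorC.

End Modules.

Record subcat (k : fieldType) (C : klinCat k) := Subcat {
  sc_hom :> forall c d : C, subspace (hom C c d);
  sc_id : forall c : C, sc_hom c c (idm c);
  sc_comp : forall (a b c : C) (g : hom C b c) (f : hom C a b),
    sc_hom b c g -> sc_hom a b f -> sc_hom a c (comp g f)
}.

Section SubcatCat.
Variables (k : fieldType) (C : klinCat k) (D : subcat C).

Definition sc_comp_sub (a b c : C) (g : sub_of (D b c)) (f : sub_of (D a b)) :
  sub_of (D a c) := mksub (sc_comp (sub_valP g) (sub_valP f)).

Definition subcat_cat : klinCat k.
Proof.
refine (@KlinCat k C (fun a b => sub_of (D a b)) (fun c => mksub (sc_id D c))
  sc_comp_sub _ _ _ _ _).
- by move=> a b c f t g h; apply: sub_val_inj; exact: comp_linl.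
- by move=> a b c g t f h; apply: sub_val_inj; exact: comp_linr.
- by move=> a b c d h g f; apply: sub_val_inj; exact: compA.
- by move=> a b f; apply: sub_val_inj; exact: comp1m.
- by move=> a b f; apply: sub_val_inj; exact: compm1.
Defined.

End SubcatCat.

Section Reedy.
Variables (k : fieldType) (disp : Order.disp_t) (L : orderType disp).

Definition direct (D : klinCat k) (deg : D -> L) : Prop :=
  (forall c, alg_iso_base (idm c) (fun g f : hom D c c => comp g f)) /\
  (forall (c c' : D) (f : hom D c c'), c <> c' -> f != 0 ->
     (deg c < deg c')%O).

Definition inverse (D : klinCat k) (deg : D -> L) : Prop :=
  (forall c, alg_iso_base (idm c) (fun g f : hom D c c => comp g f)) /\
  (forall (c c' : D) (f : hom D c c'), c <> c' -> f != 0 ->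
     (deg c' < deg c)%O).

Section CompMap.
Variables (C : klinCat k) (Cp Cm : subcat C) (I : Type) (o : I -> C) (c d : C).

Definition comp_sub (e : C) (p : sub_of (Cp e d)) (m : sub_of (Cm c e)) :
  hom C c d := comp (sub_val p) (sub_val m).

Lemma comp_sub_linearl e (m : sub_of (Cm c e)) : linear ((@comp_sub e)^~ m).
Proof. by move=> a p q; exact: comp_linl. Qed.

Lemma comp_sub_linearr e (p : sub_of (Cp e d)) : linear (comp_sub p).
Proof. by move=> a m n; exact: comp_linr. Qed.

Definition comp_map :
    {linear dsum (fun i => tensor (sub_of (Cp (o i) d)) (sub_of (Cm c (o i))))
       -> hom C c d} :=
  dsum_lift (fun i => tensor_lift (@comp_sub_linearl (o i)) (@comp_sub_linearr (o i))).

Lemma comp_map_in i p m :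
  comp_map (dsum_in
    (fun i => tensor (sub_of (Cp (o i) d)) (sub_of (Cm c (o i)))) i (tens p m))
  = comp (sub_val p) (sub_val m).
Proof. by rewrite [LHS]dsum_liftE tensor_liftE. Qed.

Lemma comp_map_ind (S : subspace (hom C c d)) :
  (forall i p m, Cp (o i) d p -> Cm c (o i) m -> S (comp p m)) ->
  forall z, S (comp_map z).
Proof.
move=> Sc; apply: (@dsum_ind _ _ _ (preim_sp comp_map S)) => i.
apply: (@tens_ind _ _ _ (preim_sp (comp_map \o dsum_in
  (fun i => tensor (sub_of (Cp (o i) d)) (sub_of (Cm c (o i)))) i) S)) => p m.
change (S (comp_map (dsum_in
  (fun i => tensor (sub_of (Cp (o i) d)) (sub_of (Cm c (o i)))) i (tens p m)))).
by rewrite comp_map_in; apply: Sc; exact: sub_valP.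
Qed.

End CompMap.

(* L stands for the ordinal; its well-foundedness is not part of this record
   and has to be assumed separately. *)
Record reedy (C : klinCat k) (deg : C -> L) := Reedy {
  rplus : subcat C;
  rminus : subcat C;
  rplus_direct : @direct (subcat_cat rplus) deg;
  rminus_inverse : @inverse (subcat_cat rminus) deg;
  reedy_iso : forall c d : C,
    bijective (comp_map rplus rminus (fun e : C => e) c d)
}.

Section Standard.
Variables (C : klinCat k) (deg : C -> L) (R : reedy deg).

Definition ideal_lt (alpha : L) (c d : C) : subspace (hom C c d) :=
  im (comp_map (rplus R) (rminus R)
    (fun e : {e : C | (deg e < alpha)%O} => sval e) c d).

Lemma ideal_lt_gen alpha c d (e : C) (p : hom C e d) (m : hom C c e) :
  (deg e < alpha)%O -> rplus R e d p -> rminus R c e m ->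
  ideal_lt alpha c d (comp p m).
Proof.
move=> elt pP mP.
exists (dsum_in (fun i : {e : C | (deg e < alpha)%O} =>
    tensor (sub_of (rplus R (sval i) d)) (sub_of (rminus R c (sval i))))
  (exist _ e elt) (tens (mksub pP) (mksub mP))).
by rewrite comp_map_in.
Qed.

Lemma ideal_lt_compl alpha c d d' (r : hom C d d') (f : hom C c d) :
  ideal_lt alpha c d f -> ideal_lt alpha c d' (comp r f).
Proof.
pose post : {linear hom C c d -> hom C c d'} := mklin (comp_linr r).
move=> [z <-]; apply: (@comp_map_ind _ _ _ _ _ _ _
  (preim_sp post (ideal_lt alpha c d'))) => -[e elt] p m _ mP.
change (ideal_lt alpha c d' (comp r (comp p m))); rewrite compA.
have [inv _ /(_ (comp r p)) <-] := reedy_iso R e d'.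
pose pre : {linear hom C e d' -> hom C c d'} := mklin (comp_linl m).
apply: (@comp_map_ind _ _ _ _ _ _ _
  (preim_sp pre (ideal_lt alpha c d'))) => e' p' m' p'P m'P.
change (ideal_lt alpha c d' (comp (comp p' m') m)); rewrite -compA.
have [->|m'0] := eqVneq m' 0.
  rewrite [comp 0 m](linear0 (mklin (comp_linl m))).
  by rewrite [comp p' 0](linear0 (mklin (comp_linr p'))); exact: sp_0.
apply: ideal_lt_gen => //; last exact: sc_comp.
have [<-//|ee'] := pselect (e = e').
apply: (lt_trans _ elt).
by apply: ((rminus_inverse R).2 _ _ (mksub m'P)).
Qed.

Lemma ideal_lt_compr alpha c c' d (r : hom C c' c) (f : hom C c d) :
  ideal_lt alpha c d f -> ideal_lt alpha c' d (comp f r).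
Proof.
pose pre : {linear hom C c d -> hom C c' d} := mklin (comp_linl r).
move=> [z <-]; apply: (@comp_map_ind _ _ _ _ _ _ _
  (preim_sp pre (ideal_lt alpha c' d))) => -[e elt] p m pP _.
change (ideal_lt alpha c' d (comp (comp p m) r)); rewrite -compA.
have [inv _ /(_ (comp m r)) <-] := reedy_iso R c' e.
pose post : {linear hom C c' e -> hom C c' d} := mklin (comp_linr p).
apply: (@comp_map_ind _ _ _ _ _ _ _
  (preim_sp post (ideal_lt alpha c' d))) => e' p' m' p'P m'P.
change (ideal_lt alpha c' d (comp p (comp p' m'))); rewrite compA.
have [->|p'0] := eqVneq p' 0.
  rewrite [comp p 0](linear0 (mklin (comp_linr p))).
  by rewrite [comp 0 m'](linear0 (mklin (comp_linl m'))); exact: sp_0.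
apply: ideal_lt_gen => //; last exact: sc_comp.
have [->//|ee'] := pselect (e' = e).
apply: (lt_trans _ elt).
by apply: ((rplus_direct R).2 _ _ (mksub p'P)).
Qed.

Definition standard_left (c : C) : cmodule C :=
  quotmod (@Submodule k C (repr_mod c) (fun d => ideal_lt (deg c) c d)
    (fun a b r x => @ideal_lt_compl (deg c) c a b r x)).

Definition standard_right (c : C) : cmodule (opcat C) :=
  quotmod (@Submodule k (opcat C) (@repr_mod k (opcat C) c)
    (fun d => ideal_lt (deg c) d c)
    (fun a b r x => @ideal_lt_compr (deg c) a b c r x)).

End Standard.

End Reedy.

(* Main.v *)
Require Import Defs.
From mathcomp Require Import all_boot all_order all_algebra.
From mathcomp Require Import boolp classical_sets.
Import Defs.

(* C is free over C^+, the standard module of c restricts to C^+(c, -), and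
   tensoring M with the right standard module of c yields
   M(c) / sum_{deg e < deg c} C(e, c) M(e), which only depends on the C^+-action.
   As Delta_d and the free modules are projective relative to C^+-linear maps,
   every resolution of Delta_d by free modules splits over C^+, so it stays
   exact under that functor: this gives Tor.  The same splitting shows that the
   resolution of Delta_c stays exact modulo the submodules generated in degrees
   < b.  If deg c <= b, then Delta_c is projective relative to the modules
   vanishing in degrees < b, so modulo these submodules the resolution even
   splits C-linearly.  For b = deg d this gives Ext^n(Delta_c, Delta_d) = 0,
   because Delta_d vanishes in degrees < b. *)

Set Implicit Arguments.
Unset Strict Implicit.
Unset Printing Implicit Defensive.

Import Order.TTheory GRing.Theory.

Local Open Scope classical_set_scope.
Local Open Scope ring_scope.

(** * Linear sections of surjections of vector spaces *)

Section LinearSection.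
Variables (k : fieldType) (V W : lmodType k) (g : {linear V -> W}).

(** Zorn's lemma on the sets [A] for which [A] together with 0 is a subspace meeting the kernel
    trivially. Adding 0 through [A0] lets the empty set, the union of the empty chain, qualify. *)
Lemma ker_complement : exists S : subspace V,
  (forall v, S v -> g v = 0 -> v = 0) /\
  (forall v, exists2 u, S u & g u = g v).
Proof.
pose A0 (A : set V) v := A v \/ v = 0.
pose P (A : set V) := (forall (a : k) u v, A0 A u -> A0 A v -> A0 A (a *: u + v))
  /\ (forall v, A v -> g v = 0 -> v = 0).
have [F FP Ftot|A [[Alin Aker] Amax]] := @Zorn_bigcup V P.
  split=> [a u v|v [X FX Xv]]; last exact: (FP _ FX).2.
  have sub (X : set V) w : F X -> A0 X w -> A0 (\bigcup_(Y in F) Y) w.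
    by move=> FX [Xw|->]; [left; exists X|right].
  case=> [[X FX Xu]|->]; case=> [[Y FY Yv]|->].
  - have [XY|YX] := Ftot X Y FX FY.
      by apply: (sub Y) => //; apply: (FP _ FY).1; left; [exact: XY|].
    by apply: (sub X) => //; apply: (FP _ FX).1; left; [|exact: YX].
  - by apply: (sub X) => //; apply: (FP _ FX).1; [left|right].
  - by apply: (sub Y) => //; apply: (FP _ FY).1; [right|left].
  - by right; rewrite scaler0 addr0.
exists (Subspace (or_intror erefl : A0 A 0) Alin); split=> [v [Av|->//]|v].
  exact: Aker.
apply: contrapT => nu.
(* If no element of [A0 A] has the same image as [v], adjoining the line through [v] contradicts
   maximality. *)
pose B : set V := [set w | exists a u, A0 A u /\ w = a *: v + u].
have AB : A `<=` B by move=> w Aw; exists 0, w; rewrite scale0r add0r; split => //; left.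
have Bv : B v by exists 1, 0; rewrite scale1r addr0; split => //; right.
apply: (Amax B); first split=> // BA.
  by apply: nu; exists v => //; left; exact: BA.
have B0 w : A0 B w -> B w.
  by move=> [//|->]; exists 0, 0; rewrite scale0r addr0; split => //; right.
split=> [a x y /B0[b [u [Au ->]]] /B0[c [w [Aw ->]]]|_ [a [u [Au ->]]] g0].
  left; exists (a * b + c), (a *: u + w); split; first exact: (Alin a u w).
  by rewrite scalerDr scalerA scalerDl addrACA.
have [a0|a0] := eqVneq a 0.
  by move: g0; rewrite a0 scale0r add0r; case: Au => [/Aker|->//].
case: nu; exists (- a^-1 *: u).
  by rewrite /= -[_ *: _]addr0; apply: (Alin _ u 0) => //; right.
move: g0; rewrite linearD linearZ /= => /eqP; rewrite addr_eq0 => /eqP gv.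
rewrite linearZ /= scaleNr -scalerN; rewrite -[g v]scale1r -(mulVf a0) -scalerA.
by rewrite -gv.
Qed.

(** Preimages inside a complement of the kernel are unique, which forces their choice to be
    linear. *)
Lemma linear_section : (forall w, exists v, g v = w) ->
  exists s : {linear W -> V}, forall w, g (s w) = w.
Proof.
move=> gS; have [S [Sinj Ssurj]] := ker_complement.
have ex w : exists u, S u /\ g u = w.
  by have [v <-] := gS w; have [u Su gu] := Ssurj v; exists u.
pose s w := sval (cid (ex w)).
have sP w : S (s w) /\ g (s w) = w := svalP (cid (ex w)).
have sL : linear s.
  move=> a x y; apply/eqP; rewrite -subr_eq0; apply/eqP/Sinj.
    apply: sp_B; first exact: (sP _).1.
    by apply: sp_lin; exact: (sP _).1.
  by rewrite linearB linearP !(sP _).2 subrr.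
by exists (mklin sL) => w; exact: (sP w).2.
Qed.

End LinearSection.

(** * The Reedy decomposition and the projection onto its C^+ part *)

Section StandardModules.
Variables (k : fieldType) (disp : Order.disp_t) (L : orderType disp).
Variables (C : klinCat k) (deg : C -> L) (R : reedy deg).

Lemma compm0 a b c (g : hom C b c) : comp g (0 : hom C a b) = 0.
Proof. exact: (linear0 (mklin (comp_linr g))). Qed.

Lemma compmZ a b c (g : hom C b c) (f : hom C a b) t :
  comp g (t *: f) = t *: comp g f.
Proof. exact: (linearZ_LR (mklin (comp_linr g))). Qed.

Lemma act0 (M : cmodule C) a b (x : M a) : act M (0 : hom C a b) x = 0.
Proof. exact: (linear0 (mklin (act_linl x))). Qed.

Lemma actZ (M : cmodule C) a b (r : hom C a b) (x : M a) t :
  act M (t *: r) x = t *: act M r x.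
Proof. exact: (linearZ_LR (mklin (act_linl x))). Qed.

Lemma subcat_scalar (D : subcat C) (c : C) :
  @alg_iso_base k (hom (subcat_cat D) c c) (idm _) (fun g f => comp g f) ->
  exists chi : {linear sub_of (D c c) -> k^o},
    (forall m, sub_val m = chi m *: idm c) /\ chi (mksub (sc_id D c)) = 1.
Proof.
move=> [f [[h fK hK] f1 _]].
have hL : linear h.
  by move=> a x y; apply: (can_inj fK); rewrite linearP !hK.
exists (mklin hL); split=> [m|]; last by rewrite -[mksub _]f1 /= fK.
rewrite -[in LHS](hK m) -[h m]mulr1 -[_ * _]/(h m *: (1 : k^o)) linearZ f1.
by [].
Qed.

Lemma plus_scalar c (p : hom C c c) : rplus R c c p -> exists a, p = a *: idm c.
Proof.
have [chi [chiE _]] := subcat_scalar ((rplus_direct R).1 c).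
by move=> pP; exists (chi (mksub pP)); rewrite -chiE.
Qed.

Lemma minus_scalar c (m : hom C c c) : rminus R c c m -> exists a, m = a *: idm c.
Proof.
have [chi [chiE _]] := subcat_scalar ((rminus_inverse R).1 c).
by move=> mP; exists (chi (mksub mP)); rewrite -chiE.
Qed.

Lemma idm_neq0 (c : C) : idm c != 0.
Proof.
have [chi [chiE chi1]] := subcat_scalar ((rplus_direct R).1 c).
apply/eqP => c0; have /eqP : chi (mksub (sc_id (rplus R) c)) = 0.
  rewrite (_ : mksub _ = 0) ?linear0 //.
  exact: sub_val_inj.
by rewrite chi1 oner_eq0.
Qed.

Lemma plus_deg c d (p : hom C c d) :
  rplus R c d p -> p != 0 -> c <> d -> (deg c < deg d)%O.
Proof. by move=> pP p0 cd; apply: ((rplus_direct R).2 _ _ (mksub pP)). Qed.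

Lemma minus_deg c d (m : hom C c d) :
  rminus R c d m -> m != 0 -> c <> d -> (deg d < deg c)%O.
Proof. by move=> mP m0 cd; apply: ((rminus_inverse R).2 _ _ (mksub mP)). Qed.

Lemma reedy_ind c d (S : subspace (hom C c d)) :
  (forall e p m, rplus R e d p -> rminus R c e m -> S (comp p m)) ->
  forall f, S f.
Proof.
move=> SP f; have [inv _ /(_ f) <-] := reedy_iso R c d.
exact: comp_map_ind.
Qed.

(** [chi] identifies C^-(c, c) with k, hence the summand at e = c with C^+(c, x); the other summands
    are sent to 0. *)
Lemma plus_part_subproof c x : exists f : {linear hom C c x -> hom C c x},
  (forall p, rplus R c x p -> f p = p) /\
  (forall e p m, rplus R e x p -> rminus R c e m -> e <> c -> f (comp p m) = 0).
Proof.
have [chi [chiE chi1]] := subcat_scalar ((rminus_inverse R).1 c).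
have [inv mapK invK] := reedy_iso R c x.
have invL : linear inv.
  by move=> a u v; apply: (can_inj mapK); rewrite linearP !invK.
pose b (p : sub_of (rplus R c x)) m := chi m *: sub_val p.
have bl m : linear (b^~ m).
  by move=> a p q; rewrite /b [sub_val _]linearP scalerDr !scalerA mulrC.
have br p : linear (b p).
  by move=> a m n; rewrite /b [chi _]linearP scalerDl scalerA.
pose T := tensor_lift bl br.
have fL : linear (fun r => T (coord (inv r) c)).
  by move=> a u v; rewrite invL coordE linearP.
have fE e p m (pP : rplus R e x p) (mP : rminus R c e m) :
    inv (comp p m) = dsum_in (fun e => tensor (sub_of (rplus R e x))
      (sub_of (rminus R c e))) e (tens (mksub pP) (mksub mP)).
  by apply: (can_inj mapK); rewrite invK comp_map_in.
exists (mklin fL); split=> [p pP|e p m pP mP ec].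
  change (T (coord (inv p) c) = p).
  (* As [p] is [comp p (idm c)], it lies in the summand at c, and [chi] of the identity is 1. *)
  rewrite -[in LHS](compm1 p) (fE _ _ _ pP (sc_id _ c)) coord_in.
  by rewrite [LHS]tensor_liftE /b -[mksub _]/(mksub (sc_id (rminus R) c)) chi1 scale1r.
change (T (coord (inv (comp p m)) c) = 0).
by rewrite fE coord_inN // linear0.
Qed.

(* The component at e = c of the decomposition of C(c, x) into the spaces
   C^+(e, x) (x) C^-(c, e). *)
Definition plus_part c x : {linear hom C c x -> hom C c x} :=
  sval (cid (plus_part_subproof c x)).

Lemma plus_part_id c x p : rplus R c x p -> plus_part c x p = p.
Proof. exact: (svalP (cid (plus_part_subproof c x))).1. Qed.

Lemma plus_partN c x e p m : rplus R e x p -> rminus R c e m -> e <> c ->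
  plus_part c x (comp p m) = 0.
Proof. exact: (svalP (cid (plus_part_subproof c x))).2. Qed.

(** Composing on the left with a morphism of C^+ keeps the middle object e, so it respects the
    decomposition. *)
Lemma plus_part_comp c x y (q : hom C x y) (r : hom C c x) :
  rplus R x y q -> plus_part c y (comp q r) = comp q (plus_part c x r).
Proof.
move=> qP; pose F : {linear hom C c x -> hom C c y} :=
  (plus_part c y \o mklin (comp_linr q)) \- (mklin (comp_linr q) \o plus_part c x).
suff : ker F r by move=> /= /eqP; rewrite subr_eq0 => /eqP.
move: r; apply: (@reedy_ind c x (ker F)) => e p m pP mP; apply/eqP.
change (plus_part c y (comp q (comp p m)) - comp q (plus_part c x (comp p m)) == 0).
rewrite subr_eq0; apply/eqP; rewrite compA.
have qpP : rplus R e y (comp q p) by exact: sc_comp.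
have [ec|ec] := pselect (e = c); last by rewrite !plus_partN // compm0.
move: p m pP mP qpP; rewrite ec => p m pP /minus_scalar[a ->] qpP.
by rewrite !compmZ !compm1 !linearZ /= compmZ !plus_part_id.
Qed.

Lemma plus_part_in c x r : rplus R c x (plus_part c x r).
Proof.
move: r; apply: (@reedy_ind c x (preim_sp (plus_part c x) (rplus R c x))).
move=> e p m pP mP /=.
have [ec|ec] := pselect (e = c); last by rewrite plus_partN //; exact: sp_0.
move: p m pP mP; rewrite ec => p m pP /minus_scalar[a ->].
by rewrite compmZ compm1 linearZ; apply: sp_Z; rewrite plus_part_id.
Qed.

(** A summand with e <> c and a nonzero factor in C^-(c, e) has deg e < deg c. Together with
    [plus_part_ideal0], the kernel of [plus_part] is exactly the ideal. *)
Lemma plus_part_ideal c x r : ideal_lt R (deg c) c x (r - plus_part c x r).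
Proof.
pose F : {linear hom C c x -> hom C c x} := idfun \- plus_part c x.
move: r; apply: (@reedy_ind c x (preim_sp F (ideal_lt R (deg c) c x))).
move=> e p m pP mP.
change (ideal_lt R (deg c) c x (comp p m - plus_part c x (comp p m))).
have [ec|ec] := pselect (e = c).
  move: p m pP mP; rewrite ec => p m pP /minus_scalar[a ->].
  by rewrite compmZ compm1 linearZ plus_part_id // subrr; exact: sp_0.
rewrite plus_partN // subr0.
have [->|m0] := eqVneq m 0; first by rewrite compm0; exact: sp_0.
by apply: ideal_lt_gen => //; apply: minus_deg m0 _ => // /esym.
Qed.

Lemma plus_part_ideal0 c x r : ideal_lt R (deg c) c x r -> plus_part c x r = 0.
Proof.
move=> [z <-]; apply: (@comp_map_ind _ _ _ _ _ _ _ _ (ker (plus_part c x))).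
move=> [e elt] p m pP mP /=; apply: plus_partN => //= ec.
by have := elt; rewrite ec ltxx.
Qed.

(** The identity of e lies in I_{<b}, which is a two-sided ideal. *)
Lemma ideal_through b c x e (r : hom C e x) (s : hom C c e) :
  (deg e < b)%O -> ideal_lt R b c x (comp r s).
Proof.
move=> elt; apply: ideal_lt_compl; rewrite -[s]comp1m; apply: ideal_lt_compr.
by rewrite -[idm e]comp1m; apply: ideal_lt_gen; first exact: elt; exact: sc_id.
Qed.

(** * Standard modules over C^+ and the maps between them *)

Definition std_gen c : standard_left R c c := proj _ (idm c).

Lemma std_genE c x (r : hom C c x) :
  act (standard_left R c) r (std_gen c) = proj _ r.
Proof. by rewrite [LHS]quotmod_actE /= compm1. Qed.

(** Together with [std_act_eq0], this makes [std_gen c] a free generator over C^+. *)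
Lemma std_plus c x (z : standard_left R c x) :
  exists2 p, rplus R c x p & z = act (standard_left R c) p (std_gen c).
Proof.
exists (plus_part c x (repr z)); first exact: plus_part_in.
rewrite std_genE -[LHS](projK z); apply/proj_eq.
exact: plus_part_ideal.
Qed.

Lemma std_act_eq0 c x p : rplus R c x p ->
  act (standard_left R c) p (std_gen c) = 0 -> p = 0.
Proof.
move=> pP; rewrite std_genE => /proj_eq0/plus_part_ideal0.
by rewrite plus_part_id.
Qed.

Lemma std_supp c x (z : standard_left R c x) :
  z != 0 -> x = c \/ (deg c < deg x)%O.
Proof.
have [p pP ->] := std_plus z => z0.
have [->|cx] := pselect (c = x); [by left|right].
apply: (plus_deg pP) cx; apply/eqP => p0; move/eqP: z0; apply.
by rewrite p0; exact: act0.
Qed.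

Lemma std_scalar c (z : standard_left R c c) : exists a, z = a *: std_gen c.
Proof.
have [_ /plus_scalar[a ->] ->] := std_plus z.
by exists a; rewrite actZ act1.
Qed.

Lemma std_gen_neq0 c : std_gen c != 0.
Proof.
apply/eqP => c0; have /eqP := idm_neq0 c; apply.
by apply: std_act_eq0; [exact: sc_id|rewrite c0 linear0].
Qed.

Lemma std_hom_ext c (N : cmodule C) (f g : modhom (standard_left R c) N) :
  mapp f (std_gen c) = mapp g (std_gen c) -> f = g.
Proof.
move=> fg; apply: modhom_ext => x z; have [p _ ->] := std_plus z.
by rewrite !mappN fg.
Qed.

(** An endomorphism is determined by the image of the generator, which is a scalar multiple of the
    generator by [std_scalar]. *)
Lemma standard_end c : alg_iso_base (modid (standard_left R c))
  (fun g f => modcomp g f).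
Proof.
pose D := standard_left R c.
have sL : linear (fun a : k^o => a *: modid D : modhom D D).
  by move=> a x y; rewrite scalerDl scalerA.
exists (mklin sL); split=> [||x y] /=; last 2 first.
- by rewrite scale1r.
- apply: modhom_ext => e z.
  change ((x * y) *: z = x *: (y *: z)); by rewrite scalerA.
have ex (f : modhom D D) : exists a, f = a *: modid D.
  have [a fa] := std_scalar (mapp f (std_gen c)); exists a.
  by apply: std_hom_ext; rewrite fa.
exists (fun f => sval (cid (ex f))) => [a|f]; last exact/esym/(svalP (cid (ex f))).
case: cid => b /= /(congr1 (fun f => mapp f (std_gen c))).
change (a *: std_gen c = b *: std_gen c -> b = a).
move=> /eqP; rewrite -subr_eq0 -scalerBl scaler_eq0 (negPf (std_gen_neq0 c)) orbF.
by rewrite subr_eq0 => /eqP.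
Qed.

Lemma standard_hom c d : nonzero (modhom (standard_left R c) (standard_left R d)) ->
  (deg d < deg c)%O \/ d = c.
Proof.
move=> [f f0]; have : mapp f (std_gen c) != 0.
  apply/eqP => fg; move/eqP: f0; apply.
  exact: std_hom_ext.
by move/std_supp => [->|]; [right|left].
Qed.

End StandardModules.

(** * Submodules generated in low degrees, and C^+-linear maps *)

Section Low.
Variables (k : fieldType) (disp : Order.disp_t) (L : orderType disp).
Variables (C : klinCat k) (deg : C -> L) (R : reedy deg).

(** This is I_{<b} M; the quotient by it is the largest quotient of M that vanishes in degrees below
    b. *)
Definition low (b : L) (M : cmodule C) (x : C) : subspace (M x) :=
  span [set z | exists (e : C) (r : hom C e x) (y : M e),
    (deg e < b)%O /\ z = act M r y].

Lemma low_gen b (M : cmodule C) e x (r : hom C e x) (y : M e) :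
  (deg e < b)%O -> low b M x (act M r y).
Proof. by move=> eb; apply: span_gen; exists e, r, y. Qed.

Lemma low_act b (M : cmodule C) x x' (s : hom C x x') z :
  low b M x z -> low b M x' (act M s z).
Proof.
move: z; apply: (@span_sub _ _ _ (preim_sp (act M s) (low b M x'))).
move=> _ [e [r [y [eb ->]]]].
by change (low b M x' (act M s (act M r y))); rewrite -actM; exact: low_gen.
Qed.

(* As C(e, x) is spanned by C^+ C^-, and morphisms of C^- do not raise the
   degree, morphisms of C^+ suffice to generate [low]. *)
Lemma low_plus_ind b (M : cmodule C) x (S : subspace (M x)) :
  (forall e p (y : M e), rplus R e x p -> (deg e < b)%O -> S (act M p y)) ->
  forall z, low b M x z -> S z.
Proof.
move=> SP; apply: span_sub => _ [e [r [y [eb ->]]]].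
move: r; apply: (@reedy_ind _ _ _ _ _ R e x
  (preim_sp (mklin (act_linl y)) S)) => e' p m pP mP.
change (S (act M (comp p m) y)); rewrite actM.
have [->|m0] := eqVneq m 0; first by rewrite act0 linear0; exact: sp_0.
apply: SP => //; have [<-//|ee'] := pselect (e = e').
by apply: (lt_trans _ eb); exact: minus_deg mP m0 ee'.
Qed.

(** Morphisms between the restrictions to C^+; the splittings of resolutions exist only at this
    level. *)
Definition plus_linear (M N : cmodule C) (f : forall c, M c -> N c) : Prop :=
  (forall c, linear (f c)) /\
  (forall a b (r : hom C a b) (x : M a),
     rplus R a b r -> f b (act M r x) = act N r (f a x)).

Lemma modhom_plus_linear (M N : cmodule C) (f : modhom M N) :
  plus_linear (fun c => @mapp k C M N f c).
Proof. by split=> [c a x y|a b r x _]; [exact: linearP|exact: mappN]. Qed.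

Lemma plus_linear_comp (M N P : cmodule C) (g : forall c, N c -> P c)
    (f : forall c, M c -> N c) :
  plus_linear g -> plus_linear f -> plus_linear (fun c x => g c (f c x)).
Proof.
move=> [gL gN] [fL fN]; split=> [c a x y|a b r x rP]; first by rewrite fL gL.
by rewrite fN // gN.
Qed.

(** Morphisms of C^+ already generate [low], so commuting with them is enough to preserve it. *)
Lemma plus_linear_low (M N : cmodule C) (f : forall c, M c -> N c) b x z :
  plus_linear f -> low b M x z -> low b N x (f x z).
Proof.
move=> [fL fN]; move: z.
apply: (@low_plus_ind b M x (preim_sp (mklin (fL x)) (low b N x))).
move=> e p y pP eb; change (low b N x (f x (act M p y))).
by rewrite fN //; exact: low_gen.
Qed.

Lemma low_surj (M N : cmodule C) (f : modhom M N) b x z :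
  surjective_hom f -> low b N x z -> exists2 y, low b M x y & mapp f y = z.
Proof.
move=> fS; pose g : {linear sub_of (low b M x) -> N x} :=
  mapp f (c := x) \o sub_val (S := low b M x).
suff /[apply] : forall z, low b N x z -> im g z.
  by move=> [y <-]; exists (sub_val y) => //; exact: sub_valP.
apply: span_sub => _ [e [r [y [eb ->]]]]; have [w <-] := fS _ y.
exists (mksub (low_gen r w eb)); exact: mappN.
Qed.

End Low.

(** * Tensoring with a right standard module *)

Section StandardTensor.
Variables (k : fieldType) (disp : Order.disp_t) (L : orderType disp).
Variables (C : klinCat k) (deg : C -> L) (R : reedy deg) (c : C).

Let G := standard_right R c.

Definition rstd_gen : G c := proj _ (idm c).

Lemma rstd_genE x (q : hom C x c) :
  @act k (opcat C) G c x q rstd_gen = proj _ q.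
Proof. by rewrite [LHS]quotmod_actE; congr proj; exact: (comp1m q). Qed.

Variable M : cmodule C.

Definition gen_tens_fun (x : M c) : tensorC G M :=
  proj _ (dsum_in (fun e : C => tensor (G e) (M e)) c (tens rstd_gen x)).

Lemma gen_tens_linear : linear gen_tens_fun.
Proof. by move=> a x y; rewrite /gen_tens_fun tens_linearr !linearP. Qed.

Definition gen_tens : {linear M c -> tensorC G M} := mklin gen_tens_linear.

Lemma gen_tens_act x (q : hom C x c) (y : M x) :
  gen_tens (act M q y) = proj (span (balanced_rel (G := G) (F := M)))
    (dsum_in (fun e : C => tensor (G e) (M e)) x (tens (proj _ q) y)).
Proof.
apply/esym/proj_eq/span_gen; exists x, c, q, rstd_gen, y.
by rewrite -rstd_genE.
Qed.

(** Balancing turns [q] (x) y into [id] (x) qy, so the tensors with the generator exhaust the tensor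
    product. *)
Lemma gen_tens_surj z : exists x, gen_tens x = z.
Proof.
rewrite -[z]projK; move: (repr z); apply: (@dsum_ind _ _ _
  (preim_sp (proj (span (balanced_rel (G := G) (F := M)))) (im gen_tens))).
move=> e; apply: (@tens_ind _ _ _ (preim_sp
  (proj (span (balanced_rel (G := G) (F := M))) \o dsum_in _ e) (im gen_tens))).
move=> g y; rewrite -[g]projK; exists (act M (repr g : hom C e c) y).
exact: gen_tens_act.
Qed.

(** Moving [r] across the tensor produces its class in the standard module, which is 0 because [r]
    factors through an object of degree below deg c. *)
Lemma gen_tens_low x : low deg (deg c) M c x -> gen_tens x = 0.
Proof.
move: x; apply: (@span_sub _ _ _ (ker gen_tens)) => _ [e [r [y [ec ->]]]].
change (gen_tens (act M r y) = 0); rewrite gen_tens_act.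
rewrite (_ : proj _ r = 0); last first.
  by apply/proj_eq0; rewrite -[r]compm1; exact: ideal_through.
by rewrite [tens _ y](linear0 (mklin (tens_linearl y))) !linear0.
Qed.

Let Q := quot_of (low deg (deg c) M c).

Lemma std_pair_subproof x (y : M x) (q : hom C x c) : ideal_lt R (deg c) x c q ->
  (proj (low deg (deg c) M c) \o mklin (act_linl y) : {linear hom C x c -> Q}) q = 0.
Proof.
move=> qI; apply/proj_eq0; move: qI => [z <-].
apply: (@comp_map_ind _ _ _ _ _ _ _ _
  (preim_sp (mklin (act_linl y)) (low deg (deg c) M c))).
move=> [e ec] p m _ _; change (low deg (deg c) M c (act M (comp p m) y)).
by rewrite actM; exact: low_gen.
Qed.

(** [q] (x) y goes to the class of qy: this induces the inverse of [gen_tens] modulo [low]. *)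
Definition std_pair x (g : G x) (y : M x) : Q := quot_lift (@std_pair_subproof x y) g.

Lemma std_pairE x (q : hom C x c) (y : M x) :
  std_pair (proj _ q) y = proj _ (act M q y).
Proof. exact: quot_liftE. Qed.

Lemma std_pair_linearl x (y : M x) : linear ((@std_pair x)^~ y).
Proof. by move=> a g h; rewrite /std_pair linearP. Qed.

Lemma std_pair_linearr x (g : G x) : linear (std_pair g).
Proof. by move=> a y z; rewrite -[g]projK !std_pairE linearP linearP. Qed.

Definition std_sum_pair : {linear dsum (fun e : C => tensor (G e) (M e)) -> Q} :=
  dsum_lift (fun e => tensor_lift (@std_pair_linearl e) (@std_pair_linearr e)).

Lemma std_sum_pairE x (g : G x) y :
  std_sum_pair (dsum_in (fun e : C => tensor (G e) (M e)) x (tens g y)) =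
  std_pair g y.
Proof. by rewrite [LHS]dsum_liftE tensor_liftE. Qed.

Lemma std_sum_pair0 z : span (balanced_rel (G := G) (F := M)) z ->
  std_sum_pair z = 0.
Proof.
move: z; apply: (@span_sub _ _ _ (ker std_sum_pair)).
move=> _ [a [b [r [g [y ->]]]]]; apply/eqP.
rewrite linearB subr_eq0 !std_sum_pairE -[g]projK; apply/eqP.
by rewrite [act G _ _]quotmod_actE !std_pairE -actM.
Qed.

(** The pairing sends [gen_tens x] back to the class of [x], so nothing outside [low] is killed. *)
Lemma gen_tens_eq0 x : gen_tens x = 0 <-> low deg (deg c) M c x.
Proof.
split; last exact: gen_tens_low.
move=> /(congr1 (quot_lift std_sum_pair0)).
rewrite linear0 quot_liftE std_sum_pairE std_pairE act1.
exact: (proj_eq0 _ x).1.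
Qed.

End StandardTensor.

(** * Factoring module maps through quotients and epimorphisms *)

Section ModuleMaps.
Variables (k : fieldType) (C : klinCat k).

Lemma mappB (M N : cmodule C) (f : modhom M N) c (x y : M c) :
  mapp f (x - y) = mapp f x - mapp f y.
Proof. exact: linearB. Qed.

Lemma mappP (M N : cmodule C) (f : modhom M N) c a (x y : M c) :
  mapp f (a *: x + y) = a *: mapp f x + mapp f y.
Proof. exact: linearP. Qed.

Lemma quotmod_lift (M N : cmodule C) (S : submodule M) (f : modhom M N) :
  (forall c x, S c x -> mapp f x = 0) ->
  exists f' : modhom (quotmod S) N, forall c x, mapp f' (proj (S c) x) = mapp f x.
Proof.
move=> f0.
pose h c : {linear quot_of (S c) -> N c} :=
  quot_lift (f := mapp f (c := c) : {linear M c -> N c}) (f0 c).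
have hE c x : h c (proj (S c) x) = mapp f x by exact: quot_liftE.
have hP : @is_modhom k C (quotmod S) N h.
  split=> [c|a b r x]; first exact: linearP.
  by rewrite -[x]projK [act _ _ _]quotmod_actE !hE mappN.
by exists (mkmodhom hP) => c x; exact: hE.
Qed.

(** The value at y is [f] of any preimage; its independence of the preimage gives linearity and
    naturality, although [s] is a mere choice. *)
Lemma modhom_factor (M X N : cmodule C) (p : modhom M X) (f : modhom M N) :
  surjective_hom p -> (forall c (x : M c), mapp p x = 0 -> mapp f x = 0) ->
  exists f' : modhom X N, modcomp f' p = f.
Proof.
move=> pS f0.
pose s c (y : X c) := sval (cid (pS c y)).
have sP c y : mapp p (s c y) = y by exact: svalP (cid (pS c y)).
pose h c (y : X c) := mapp f (s c y).
have hE c x : h c (mapp p x) = mapp f x.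
  apply/eqP; rewrite -subr_eq0 -mappB; apply/eqP/f0.
  by rewrite mappB sP subrr.
have hP : is_modhom h.
  split=> [c a x y|a b r x].
    by rewrite -[x]sP -[y]sP -mappP !hE mappP.
  by rewrite -[x]sP -mappN !hE mappN.
by exists (mkmodhom hP); apply: modhom_ext => c x; exact: hE.
Qed.

End ModuleMaps.

(** * Projectivity relative to C^+ *)

Section PlusProjective.
Variables (k : fieldType) (disp : Order.disp_t) (L : orderType disp).
Variables (C : klinCat k) (deg : C -> L) (R : reedy deg).

(** The epimorphism is C-linear, while the given map and its lift need only commute with C^+. *)
Definition plus_projective (M : cmodule C) : Prop :=
  forall (A B : cmodule C) (g : modhom A B), surjective_hom g ->
  forall f : (forall c, M c -> B c), plus_linear R f ->
  exists h : forall c, M c -> A c,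
    plus_linear R h /\ forall c x, mapp g (h c x) = f c x.

(** Over C^+ the standard module is free on its generator, so a preimage [a] of the image of the
    generator determines the lift. *)
Lemma plus_projective_std c : plus_projective (standard_left R c).
Proof.
move=> A B g gS f [fL fN]; have [a ga] := gS _ (f c (std_gen R c)).
have h0 x r : ideal_lt R (deg c) c x r ->
    (mklin (act_linl a) \o plus_part R c x : {linear hom C c x -> A x}) r = 0.
  by move=> /plus_part_ideal0 /= ->; exact: act0.
pose h x := quot_lift (h0 x).
have hE x r : h x (proj _ r) = act A (plus_part R c x r) a by exact: quot_liftE.
exists (fun x => h x); split; first split=> [x|x y r z rP]; first exact: linearP.
  rewrite -[z]projK [act _ _ _]quotmod_actE !hE -actM.
  by congr (act A _ a); exact: plus_part_comp.
move=> x z; rewrite -[z]projK hE mappN ga -fN; last exact: plus_part_in.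
congr (f x _); rewrite std_genE; apply/esym/proj_eq.
exact: plus_part_ideal.
Qed.

(* By the Reedy decomposition C(c, -) is, over C^+, the direct sum of the
   C^+(e, -) (x) C^-(c, e). *)
Lemma plus_projective_repr c : plus_projective (repr_mod c).
Proof.
move=> A B g gS f [fL fN].
(* The lift is free to choose on the vector spaces C^-(c, e), where a linear section of [g]
   suffices; the action of C^+ extends it. *)
have sx e : exists s : {linear B e -> A e}, forall w, mapp g (s w) = w.
  exact: (linear_section (g := mapp g (c := e) : {linear A e -> B e}) (gS e)).
pose s e := sval (cid (sx e)).
have sP e w : mapp g (s e w) = w by exact: (svalP (cid (sx e)) w).
have hx x : exists h : {linear hom C c x -> A x}, forall e p m,
    rplus R e x p -> rminus R c e m -> h (comp p m) = act A p (s e (f e m)).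
  have [inv mapK invK] := reedy_iso R c x.
  have invL : linear inv.
    by move=> a u v; apply: (can_inj mapK); rewrite linearP !invK.
  pose b e (p : sub_of (rplus R e x)) (m : sub_of (rminus R c e)) :=
    act A (sub_val p) (s e (f e (sub_val m))).
  have bl e m : linear ((b e)^~ m) by move=> a p q; exact: act_linl.
  have br e p : linear (b e p).
    move=> a m n; rewrite /b.
    by rewrite -[sub_val (_ + _)]/(a *: sub_val m + sub_val n) fL !linearP.
  pose T := dsum_lift (fun e => tensor_lift (bl e) (br e)).
  have hL : linear (fun r => T (inv r)) by move=> a u v; rewrite invL linearP.
  exists (mklin hL) => e p m pP mP.
  change (T (inv (comp p m)) = b e (mksub pP) (mksub mP)).
  have -> : inv (comp p m) = dsum_in (fun e => tensor (sub_of (rplus R e x))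
      (sub_of (rminus R c e))) e (tens (mksub pP) (mksub mP)).
    by apply: (can_inj mapK); rewrite invK comp_map_in.
  by rewrite [LHS]dsum_liftE tensor_liftE.
pose h x := sval (cid (hx x)).
have hE x e p m : rplus R e x p -> rminus R c e m ->
  h x (comp p m) = act A p (s e (f e m)).
  exact: (svalP (cid (hx x))).
exists (fun x => h x); split; first split=> [x|x y q r qP]; first exact: linearP.
  pose F : {linear hom C c x -> A y} :=
    (h y \o mklin (comp_linr q)) \- (act A q \o h x).
  suff : ker F r by move=> /= /eqP; rewrite subr_eq0 => /eqP.
  move: r; apply: (@reedy_ind _ _ _ _ _ R _ _ (ker F)) => e p m pP mP; apply/eqP.
  change (h y (comp q (comp p m)) - act A q (h x (comp p m)) == 0).
  by rewrite subr_eq0 compA !hE ?actM //; exact: sc_comp.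
move=> x r; pose F : {linear hom C c x -> B x} :=
  (mapp g (c := x) \o h x) \- mklin (fL x).
suff : ker F r by move=> /= /eqP; rewrite subr_eq0 => /eqP.
move: r; apply: (@reedy_ind _ _ _ _ _ R _ _ (ker F)) => e p m pP mP; apply/eqP.
change (mapp g (h x (comp p m)) - f x (comp p m) == 0).
by rewrite subr_eq0 hE // mappN sP -fN.
Qed.

Lemma plus_projective_sum I (Ms : I -> cmodule C) :
  (forall i, plus_projective (Ms i)) -> plus_projective (summod Ms).
Proof.
move=> MsP A B g gS f [fL fN].
have hx i : exists h : forall c, Ms i c -> A c, plus_linear R h /\
    forall c x, mapp g (h c x) = f c (dsum_in (fun i => Ms i c) i x).
  apply: (MsP i A B g gS (fun c x => f c (dsum_in (fun i => Ms i c) i x))).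
  split=> [c a x y|a b r x rP]; first by rewrite linearP fL.
  by rewrite -fN // [act (summod _) _ _]dsum_map_in.
pose h i := sval (cid (hx i)).
have hL i c : linear (h i c) by exact: (svalP (cid (hx i))).1.1.
have hN i a b (r : hom C a b) x :
    rplus R a b r -> h i b (act (Ms i) r x) = act A r (h i a x).
  exact: (svalP (cid (hx i))).1.2.
have hg i c x : mapp g (h i c x) = f c (dsum_in (fun i => Ms i c) i x).
  exact: (svalP (cid (hx i))).2.
pose H c : {linear summod Ms c -> A c} := dsum_lift (fun i => mklin (hL i c)).
have HE i c x : H c (dsum_in (fun i => Ms i c) i x) = h i c x by exact: dsum_liftE.
exists (fun c => H c); split; first split=> [c|a b r x rP]; first exact: linearP.
  pose F1 : {linear summod Ms a -> A b} := H b \o act (summod Ms) r.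
  pose F2 : {linear summod Ms a -> A b} := act A r \o H a.
  move: x; apply: (dsum_ext (f := F1) (g := F2)) => i v.
  change (H b (summod_act Ms r (dsum_in (fun i => Ms i a) i v)) =
    act A r (H a (dsum_in (fun i => Ms i a) i v))).
  by rewrite [summod_act _ _ _]dsum_map_in !HE hN.
move=> c; pose F1 : {linear summod Ms c -> B c} := mapp g (c := c) \o H c.
apply: (dsum_ext (f := F1) (g := mklin (fL c))) => i v.
change (mapp g (H c (dsum_in (fun i => Ms i c) i v)) =
  f c (dsum_in (fun i => Ms i c) i v)).
by rewrite HE.
Qed.

Lemma plus_projective_cover M : plus_projective (cover M).
Proof. by apply: plus_projective_sum => i; exact: plus_projective_repr. Qed.

Section Kernel.
Variables (P M : cmodule C) (g : modhom P M).
Hypotheses (gS : surjective_hom g) (MP : plus_projective M).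

(** Lifting the identity of M gives a C^+-linear section [s]; the retraction is x - s(g x). *)
Lemma plus_retraction : exists rho : forall c, P c -> kermod g c,
  plus_linear R rho /\ forall c (x : kermod g c), rho c (mapp (kerincl g) x) = x.
Proof.
have [s [[sL sN] sP]] := MP gS (modhom_plus_linear R (modid M)).
have kerS c x : ker (@mapp k C P M g c) (x - s c (mapp g x)).
  by change (mapp g (x - s c (mapp g x)) = 0); rewrite mappB sP subrr.
exists (fun c x => mksub (kerS c x)); split; first split=> [c a x y|a b r x rP].
- apply: sub_val_inj; change (a *: x + y - s c (mapp g (a *: x + y)) =
    a *: (x - s c (mapp g x)) + (y - s c (mapp g y))).
  by rewrite mappP sL scalerBr opprD addrACA.
- apply: sub_val_inj; change (act P r x - s b (mapp g (act P r x)) =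
    act P r (x - s a (mapp g x))).
  by rewrite mappN sN // linearB.
- move=> c x; apply: sub_val_inj.
  change (sub_val x - s c (mapp g (sub_val x)) = sub_val x).
  have -> : mapp g (sub_val x) = 0 by exact: (sub_valP x).
  by rewrite [s c 0](linear0 (mklin (sL c))) subr0.
Qed.

(** The C^+-linear retraction preserves [low] and fixes the kernel. Hence the kernel still injects
    into P modulo [low]. *)
Lemma low_ker b c (x : kermod g c) :
  low deg b P c (mapp (kerincl g) x) -> low deg b (kermod g) c x.
Proof.
have [rho [rhoL rhoK]] := plus_retraction.
by move=> /(plus_linear_low rhoL); rewrite rhoK.
Qed.

(** Extend a map to P along the retraction, lift it there, and restrict the lift to the kernel. *)
Lemma plus_projective_ker : plus_projective P -> plus_projective (kermod g).
Proof.
have [rho [rhoL rhoK]] := plus_retraction.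
move=> PP A B q qS f fL.
have [h [hL hq]] := PP _ _ q qS _ (plus_linear_comp fL rhoL).
exists (fun c x => h c (mapp (kerincl g) x)); split.
  exact: plus_linear_comp hL (modhom_plus_linear R (kerincl g)).
by move=> c x; rewrite hq rhoK.
Qed.

End Kernel.

Lemma plus_projective_syzygy M n : plus_projective M -> plus_projective (syzygy M n).
Proof.
move=> MP; elim: n => [//|n IHn] /=.
by apply: plus_projective_ker => //; [exact: cover_surj|exact: plus_projective_cover].
Qed.

End PlusProjective.

(** * Projectivity relative to modules vanishing below degree b, and Ext *)

Section RelativeProjective.
Variables (k : fieldType) (disp : Order.disp_t) (L : orderType disp).
Variables (C : klinCat k) (deg : C -> L) (R : reedy deg) (b : L).

Definition vanishes_below (M : cmodule C) : Prop :=
  forall e, (deg e < b)%O -> forall x : M e, x = 0.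

(* Projectivity relative to the modules over C / I_{<b}. *)
Definition proj_above (M : cmodule C) : Prop :=
  forall (A B : cmodule C) (g : modhom A B), vanishes_below A ->
  vanishes_below B -> surjective_hom g ->
  forall f : modhom M B, exists h : modhom M A, modcomp g h = f.

Lemma vanishes_below_std c : (b <= deg c)%O -> vanishes_below (standard_left R c).
Proof.
move=> bc e eb x; apply/eqP; apply: contraT => /std_supp[ec|ce].
  by move: eb; rewrite ec ltNge bc.
by have := lt_le_trans (lt_trans ce eb) bc; rewrite ltxx.
Qed.

(** A map out of the standard module is an element of A(c) killed by I_{<deg c}. When deg c <= b and
    A vanishes below b, every element of A(c) is killed. *)
Lemma proj_above_std c : (deg c <= b)%O -> proj_above (standard_left R c).
Proof.
move=> cb A B g A0 _ gS f; have [a ga] := gS _ (mapp f (std_gen R c)).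
have [|h hE] := @quotmod_lift k C (repr_mod c) A
    (@Submodule k C (repr_mod c) (fun d => ideal_lt R (deg c) c d)
       (fun a b r x => @ideal_lt_compl _ _ _ _ _ R (deg c) c a b r x)) (yoneda a).
  move=> x r [z <-]; apply: (@comp_map_ind _ _ _ _ _ _ _ _
    (ker (mklin (act_linl a)))) => -[e ec] p m _ _.
  change (act A (comp p m) a = 0); rewrite actM.
  by rewrite (A0 e (lt_le_trans ec cb) (act A m a)) linear0.
exists h; apply: (std_hom_ext (R := R)).
change (mapp g (mapp h (std_gen R c)) = mapp f (std_gen R c)).
rewrite [mapp h _]hE -ga; congr (mapp g _); exact: act1.
Qed.

Lemma low_vanishes (M : cmodule C) c x : vanishes_below M -> low deg b M c x -> x = 0.
Proof.
move=> M0; move: x; apply: (@span_sub _ _ _ (ker (idfun : {linear M c -> M c}))).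
by move=> _ [e [r [y [eb ->]]]] /=; rewrite (M0 _ eb y) linear0.
Qed.

Definition low_submod (M : cmodule C) : submodule M :=
  @Submodule k C M (low deg b M) (fun x y s z => @low_act _ _ _ _ _ b M x y s z).

Lemma vanishes_below_quot (M : cmodule C) : vanishes_below (quotmod (low_submod M)).
Proof.
move=> e eb x; rewrite -[x]projK; apply/proj_eq0; rewrite -[repr x]act1.
exact: low_gen.
Qed.

Section Kernel.
Variables (P M : cmodule C) (g : modhom P M).
Hypotheses (gS : surjective_hom g) (MP : plus_projective R M) (Mb : proj_above M).

(* By low_ker the sequence stays exact modulo the submodules [low], where it
   splits because M is projective there. *)
Lemma ker_extend (N : cmodule C) (f : modhom (kermod g) N) : vanishes_below N ->
  exists h : modhom P N, modcomp h (kerincl g) = f.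
Proof.
move=> N0; pose pP c := proj (low deg b P c); pose pM c := proj (low deg b M c).
have pPL c a x y : pP c (a *: x + y) = a *: pP c x + pP c y by exact: linearP.
have pM_hom : @is_modhom k C M (quotmod (low_submod M)) pM.
  split=> [c|x y r z]; first exact: linearP.
  by rewrite [RHS]quotmod_actE.
pose can : modhom M (quotmod (low_submod M)) := mkmodhom pM_hom.
have [|gb gbE] := @quotmod_lift k C P _ (low_submod P) (modcomp can g).
  move=> c x xl; apply/proj_eq0.
  exact: (plus_linear_low (modhom_plus_linear R g)).
have gbS : surjective_hom gb.
  move=> c y; have [x xP] := gS (repr y); exists (pP c x).
  by rewrite gbE -[RHS]projK -xP.
(* Both quotients vanish below b, so relative projectivity of M lifts the projection [can] through
   [gb]. *)
have [s sE] := Mb (@vanishes_below_quot P) (@vanishes_below_quot M) gbS can.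
(* [u] represents x - s(g x), the component of x in the kernel modulo [low]; the extension will send
   x to [f u]. *)
pose E c (x : P c) (u : kermod g c) :=
  pP c (mapp (kerincl g) u) = pP c x - mapp s (mapp g x).
have Eex c x : exists u, E c x u.
  have [w wE] : exists w, pP c w = pP c x - mapp s (mapp g x).
    by exists (repr (pP c x - mapp s (mapp g x))); exact: projK.
  have : low deg b M c (mapp g w).
    apply/proj_eq0; rewrite -[LHS]/(mapp can (mapp g w)) -[LHS]/(mapp (modcomp can g) w).
    rewrite -gbE -[proj _ _]/(pP c w) wE mappB gbE.
    by rewrite -[mapp gb (mapp s _)]/(mapp (modcomp gb s) (mapp g x)) sE subrr.
  (* The representative [w] lies in the kernel only modulo [low]; subtracting [y] from [low] of P
     corrects this. *)
  move=> /(low_surj gS)[y yl yw].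
  have uP : ker (@mapp k C P M g c) (w - y).
    by change (mapp g (w - y) = 0); rewrite mappB yw subrr.
  exists (mksub uP); rewrite /E -wE; apply/proj_eq.
  change (low deg b P c (w - y - w)); rewrite addrAC subrr add0r -scaleN1r.
  exact: sp_Z.
(* Two representatives differ by an element of [low] of P, hence of [low] of the kernel by
   [low_ker], and [f] kills that since N vanishes below b. *)
have fE c x u v : E c x u -> E c x v -> mapp f u = mapp f v.
  move=> Eu Ev; apply/eqP; rewrite -subr_eq0 -mappB; apply/eqP.
  apply: (low_vanishes N0); apply: (plus_linear_low (modhom_plus_linear R f)).
  apply: (low_ker gS MP); rewrite mappB; apply/proj_eq.
  by rewrite -[LHS]/(pP c _) Eu -Ev.
pose F c (x : P c) := mapp f (sval (cid (Eex c x))).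
have FE c x u : E c x u -> F c x = mapp f u by apply: fE; exact: svalP (cid (Eex c x)).
have FP : is_modhom F.
  split=> [c a x y|x y r z].
    have [u Eu] := Eex c x; have [v Ev] := Eex c y.
    rewrite (FE c x u Eu) (FE c y v Ev) -mappP; apply: FE.
    rewrite /E !mappP !pPL Eu Ev scalerBr opprD addrACA.
    by congr (_ + _).
  have [u Eu] := Eex x z; rewrite (FE x z u Eu) -mappN; apply: FE.
  have actE t : pP y (act P r t) = act (quotmod (low_submod P)) r (pP x t).
    by rewrite [RHS]quotmod_actE.
  by rewrite /E !mappN !actE Eu linearB.
exists (mkmodhom FP); apply: modhom_ext => c u; apply: FE.
have gu : mapp g (mapp (kerincl g) u) = 0 by exact: (sub_valP u).
by rewrite /E gu linear0 subr0.
Qed.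

Lemma proj_above_ker : proj_above P -> proj_above (kermod g).
Proof.
move=> Pb A B q A0 B0 qS f; have [f' <-] := ker_extend f B0.
have [h <-] := Pb A B q A0 B0 qS f'.
by exists (modcomp h (kerincl g)); exact: modhom_ext.
Qed.

End Kernel.

Lemma proj_above_syzygy M n : plus_projective R M -> proj_above M ->
  proj_above (syzygy M n).
Proof.
move=> MP Mb; elim: n => [//|n IHn] /=; apply: proj_above_ker => //.
- exact: cover_surj.
- exact: plus_projective_syzygy.
- by move=> A B g _ _; exact: free_mod_projective.
Qed.

(** A cocycle on the free module in degree n+1 factors through the syzygy n+1, a submodule of the
    free module in degree n. Extending it there by [ker_extend] exhibits it as a coboundary. *)
Lemma Ext_vanishing (M N : cmodule C) n : plus_projective R M -> proj_above M ->
  vanishes_below N -> ~ nonzero (Ext n.+1 M N).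
Proof.
move=> MP Mb N0 [x /eqP]; apply.
rewrite -[x]projK; apply/proj_eq0; move: (repr x) => {x} z.
have : modcomp (sub_val z) (free_diff M n.+1) = 0 by exact: (sub_valP z).
change (modcomp (sub_val z) (free_diff M n.+1) = 0 ->
  im (precomp N (free_diff M n)) (sub_val z)).
move: (sub_val z) => {z} f f0.
have [||f' <-] := modhom_factor (p := cover_map (syzygy M n.+1)) (f := f).
- exact: cover_surj.
- move=> c y /free_exact[w <-].
  by rewrite -[LHS]/(mapp (modcomp f (free_diff M n.+1)) w) f0.
have [h <-] := ker_extend (@cover_surj _ _ (syzygy M n))
  (plus_projective_syzygy (n := n) MP) (@proj_above_syzygy M n MP Mb) f' N0.
by exists h; exact: modhom_ext.
Qed.

End RelativeProjective.

(** * Tor of standard modules *)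

Section StandardTor.
Variables (k : fieldType) (disp : Order.disp_t) (L : orderType disp).
Variables (C : klinCat k) (deg : C -> L) (R : reedy deg).

Lemma tensorC_map_gen c (M N : cmodule C) (f : modhom M N) (x : M c) :
  tensorC_map (standard_right R c) f (gen_tens R c M x) = gen_tens R c N (mapp f x).
Proof. by rewrite [LHS]quot_liftE tens_sum_map_in. Qed.

(** Subtracting from [x] an element of [low] with the same image changes nothing after tensoring and
    leaves an element of the kernel, which is a boundary by exactness. *)
Lemma gen_tens_boundary c (M : cmodule C) n (x : cover (syzygy M n) c) :
  low deg (deg c) (syzygy M n) c (mapp (cover_map (syzygy M n)) x) ->
  im (tensorC_map (standard_right R c) (free_diff M n)) (gen_tens R c _ x).
Proof.
move=> /(low_surj (@cover_surj _ _ _))[y /(gen_tens_low R) y0 yx].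
have /free_exact[w wE] : mapp (cover_map (syzygy M n)) (x - y) = 0.
  by rewrite mappB yx subrr.
exists (gen_tens R c _ w); rewrite tensorC_map_gen wE.
by rewrite linearB [X in _ - X]y0 subr0.
Qed.

(** A cycle is given by [x] whose differential lies in [low] of the free module; by [low_ker] it
    lies in [low] of the syzygy, so [gen_tens_boundary] applies. *)
Lemma Tor_vanishing c (M : cmodule C) n :
  plus_projective R M -> ~ nonzero (Tor (standard_right R c) n.+1 M).
Proof.
move=> MP [x /eqP]; apply; rewrite -[x]projK; apply/proj_eq0.
move: (repr x) => {x} z.
have : tensorC_map (standard_right R c) (free_diff M n) (sub_val z) = 0.
  exact: (sub_valP z).
change (tensorC_map (standard_right R c) (free_diff M n) (sub_val z) = 0 ->
  im (tensorC_map (standard_right R c) (free_diff M n.+1)) (sub_val z)).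
move: (sub_val z) => {}z.
have [x <-] := gen_tens_surj z; rewrite tensorC_map_gen => /gen_tens_eq0 xl.
apply: gen_tens_boundary.
exact: (low_ker (@cover_surj _ _ _) (plus_projective_syzygy (n := n) MP) xl).
Qed.

(** A nonzero morphism d -> c of C^+ with c <> d forces deg d < deg c, so everything at c comes from
    lower degree. *)
Lemma low_std c d (z : standard_left R d c) : c <> d ->
  low deg (deg c) (standard_left R d) c z.
Proof.
move=> cd; have [p pP ->] := std_plus z.
have [->|p0] := eqVneq p 0; first by rewrite act0; exact: sp_0.
by apply/low_gen/(plus_deg pP p0) => /esym.
Qed.

Lemma low_std_eq0 c z : low deg (deg c) (standard_left R c) c z -> z = 0.
Proof. by apply: low_vanishes; exact: vanishes_below_std. Qed.

(** A lift of the generator to the cover gives the nonzero class: were it a boundary, the generator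
    would lie in [low] at c, which is 0. *)
Lemma Tor0_std c : nonzero (Tor (standard_right R c) 0 (standard_left R c)).
Proof.
pose M := standard_left R c.
pose S := im (tensorC_map (standard_right R c) (free_diff M 0)).
have [x xE] := @cover_surj _ _ M c (std_gen R c).
pose K := ker (\0 : {linear tensorC (standard_right R c) (cover M) ->
  tensorC (standard_right R c) (cover M)}).
have uP : K (gen_tens R c _ x) by [].
exists (proj (preim_sp (sub_val (S := K)) S) (mksub uP)); apply/eqP => /proj_eq0.
change (S (gen_tens R c _ x) -> False) => -[z].
have [y <-] := gen_tens_surj z; rewrite tensorC_map_gen => yx.
have /gen_tens_eq0 : gen_tens R c _ (x - mapp (free_diff M 0) y) = 0.
  by rewrite linearB [X in _ - X]yx [LHS]subrr.
move=> /(plus_linear_low (modhom_plus_linear R (cover_map M))).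
have dy0 : mapp (cover_map M) (mapp (free_diff M 0) y) = 0.
  by apply/(free_exact (M := M) (n := 0)); exists y.
rewrite mappB dy0 xE subr0 => /low_std_eq0/eqP.
exact/negP/std_gen_neq0.
Qed.

Lemma Tor0_stdN c d : c <> d ->
  ~ nonzero (Tor (standard_right R c) 0 (standard_left R d)).
Proof.
move=> cd [z /eqP]; apply; rewrite -[z]projK; apply/proj_eq0.
change (im (tensorC_map (standard_right R c) (free_diff (standard_left R d) 0))
  (sub_val (repr z))).
have [x <-] := gen_tens_surj (sub_val (repr z)).
exact/gen_tens_boundary/low_std.
Qed.

(** At c the standard module is the line of its generator and its [low] part is 0, so [gen_tens] is
    an isomorphism from that line. *)
Lemma standard_tensor c :
  lin_iso (k^o) (tensorC (standard_right R c) (standard_left R c)).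
Proof.
pose v := gen_tens R c (standard_left R c) (std_gen R c).
have fL : linear (fun a : k^o => a *: v).
  by move=> a x y; rewrite scalerDl scalerA.
have ex z : exists a, z = a *: v.
  have [x <-] := gen_tens_surj z; have [a ->] := std_scalar x.
  by exists a; exact: (linearZ_LR (gen_tens R c _)).
pose g z := sval (cid (ex z)).
have gE z : z = g z *: v := svalP (cid (ex z)).
have v0 : v <> 0.
  move=> /gen_tens_eq0/low_std_eq0/eqP.
  exact/negP/std_gen_neq0.
exists (mklin fL), g => [a|z]; last first.
  by change (g z *: v = z); rewrite -gE.
change (g (a *: v) = a); have /eqP := gE (a *: v).
rewrite -subr_eq0 -scalerBl scaler_eq0 => /orP[|/eqP//].
by rewrite subr_eq0 => /eqP.
Qed.

End StandardTor.

Theorem theorem4p7 (k : fieldType) (disp : Order.disp_t) (L : orderType disp)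
    (L_wf : well_founded (fun x y : L => (x < y)%O))
    (C : klinCat k) (deg : C -> L) (R : @reedy k disp L C deg) (c d : C) :
  [/\ (alg_iso_base (modid (standard_left R c))
         (fun g f => modcomp g f) /\
       lin_iso (k^o)%R (tensorC (standard_right R c) (standard_left R c))),
      (nonzero (modhom (standard_left R c) (standard_left R d)) ->
         (deg d < deg c)%O \/ d = c),
      (forall n : nat, (1 <= n)%N ->
         nonzero (Ext n (standard_left R c) (standard_left R d)) ->
         (deg d < deg c)%O)
    & (forall n : nat,
         nonzero (Tor (standard_right R c) n (standard_left R d)) <->
         n = 0%N /\ c = d)].
Proof.
have cP := @plus_projective_std _ _ _ _ _ R c.
have dP := @plus_projective_std _ _ _ _ _ R d.
split.
- by split; [exact: standard_end|exact: standard_tensor].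
- exact: standard_hom.
(* By contraposition deg c <= deg d, and the threshold b = deg d serves both modules at once. *)
- case=> // n _ En; rewrite ltNge; apply/negP => cd; move: En.
  apply: (Ext_vanishing (b := deg d) cP); first exact: proj_above_std.
  exact: vanishes_below_std.
- case=> [|n]; last by split=> [/(Tor_vanishing dP)|[]].
  split=> [T0|[_ <-]]; last exact: Tor0_std.
  by split=> //; apply: contrapT => cd; exact: Tor0_stdN cd T0.
Qed.
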